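(* Let $$\epsilon=-\frac{\log\Bigl(1-\frac{2}{2+\cos(\pi/13)+\sin(3\pi/26)}\Bigr)}{3\log 13}\approx 0.1195.$$ There exists a self-compatible family $(g^{(q)})_{q\ge 1}$ of cubic modular witness functions such that, for every $q\ge1$, the constant term $b_0$ of $g^{(q)}$ satisfies $b_0\le q^{-\epsilon}$. In particular $\lambda(C_0^{(q)})\le q^{-\epsilon}$ for every $q\ge 1$.
   Context: Notation: $e(x)=e^{2\pi i x}$. For a positive integer $q$, a cubic modular witness function modulo $q$ is a function of the form $g^{(q)}(y)=b_0+\sum_{1\le j\le q-1,\ q\nmid j^3} b_j\bigl(e(j^3y/q)+e(-j^3y/q)\bigr)$ with real coefficients $b_j$ (depending on $q$), satisfying $g^{(q)}(y)\ge 0$ for all $y=0,1,\dots,q-1$ and $g^{(q)}(0)=1$. A family $g^{(q)}$ ($q=1,2,\dots$) of such functions is called self-compatible if $g^{(q_1)}(y_1)=g^{(q_2)}(y_2)$ whenever $y_1/q_1=y_2/q_2$. Let $C^{(q)}$ be the set of nonzero cubic residues modulo $q$ (nonzero $x\in\mathbb{Z}_q$ with $x\equiv j^3\pmod q$ for some integer $j$), $C_0^{(q)}=C^{(q)}\cup\{0\}$, and $\lambda(C_0^{(q)})$ the minimal possible value of the constant term $b_0$ over all cubic modular witness functions modulo $q$. *)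

(* Defs.v *)
From HB Require Import structures.
From mathcomp Require Import all_boot all_order all_algebra.
From mathcomp Require Import all_classical all_reals all_analysis.
From mathcomp Require Import complex ring lra.

Set Implicit Arguments.
Unset Strict Implicit.
Unset Printing Implicit Defensive.

Import Order.TTheory GRing.Theory Num.Theory.
Import numFieldNormedType.Exports.

Local Open Scope classical_set_scope.
Local Open Scope ring_scope.
Local Open Scope complex_scope.

(* e(x) = exp(2 pi i x) *)
Definition e_unit (R : realType) (x : R) : R[i] :=
  cos (2 * pi * x) +i* sin (2 * pi * x).

(* Only the coefficients [b 0] (the constant term of [g]) and [b j] with
   [0 < j < q] and [~~ (q %| j ^ 3)] matter.  The term [e(x) + e(-x)] is real
   but lives in [R[i]], hence the embedding of [g y] and of the [b j]. *)
Definition cubic_modular_witness (R : realType) (q : nat)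
    (b : nat -> R) (g : int -> R) : Prop :=
  [/\ forall y : int,
        (g y)%:C = (b 0%N)%:C +
          \sum_(1 <= j < q | ~~ (q %| j ^ 3)%N)
            (b j)%:C * (e_unit ((j ^ 3)%N%:R * y%:~R / q%:R) +
                        e_unit (- ((j ^ 3)%N%:R * y%:~R / q%:R))),
      forall y : nat, (y < q)%N -> 0 <= g y%:Z
    & g 0 = 1].

Definition self_compatible (R : realType) (g : nat -> int -> R) : Prop :=
  forall (q1 q2 : nat) (y1 y2 : int), (0 < q1)%N -> (0 < q2)%N ->
    y1%:Q / q1%:Q = y2%:Q / q2%:Q -> g q1 y1 = g q2 y2.

Definition witness_constant_terms (R : realType) (q : nat) : set R :=
  [set c | exists (b : nat -> R) (g : int -> R),
             cubic_modular_witness q b g /\ c = b 0%N].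

(* The infimum is a minimum: see [lambda_C0_min] below. *)
Definition lambda_C0 (R : realType) (q : nat) : R :=
  inf (@witness_constant_terms R q).

Definition epsilon13 (R : realType) : R :=
  - (ln (1 - 2 / (2 + cos (pi / 13) + sin (3 * pi / 26))) / (3 * ln 13)).

Section minimum.
Context (R : realType).
Implicit Types (q j : nat) (b : nat -> R).

Let kern q j (y : int) : R := 2 * cos (2 * pi * ((j ^ 3)%N%:R * y%:~R / q%:R)).

Let wfun q b (y : int) : R :=
  b 0%N + \sum_(1 <= j < q | ~~ (q %| j ^ 3)%N) b j * kern q j y.

Let wfunE q b y : (wfun q b y)%:C = (b 0%N)%:C +
  \sum_(1 <= j < q | ~~ (q %| j ^ 3)%N)
    (b j)%:C * (e_unit ((j ^ 3)%N%:R * y%:~R / q%:R) +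
                e_unit (- ((j ^ 3)%N%:R * y%:~R / q%:R))).
Proof.
rewrite /wfun rmorphD rmorph_sum /=; congr (_ + _); apply: eq_bigr => j _.
rewrite rmorphM /=; congr (_ * _); rewrite /e_unit /kern mulrN cosN sinN.
by apply/eqP; rewrite eq_complex /= subrr eqxx andbT; apply/eqP; ring.
Qed.

Let witnessE q b g : cubic_modular_witness q b g <->
  [/\ g = wfun q b, forall y : nat, (y < q)%N -> 0 <= g y%:Z & g 0 = 1].
Proof.
split=> -[gE g0 g1]; split=> //; last by move=> y; rewrite gE wfunE.
by apply/funext => y; move: (gE y); rewrite -wfunE => -[].
Qed.

Let sum_cos q k : ~~ (q %| k)%N ->
  \sum_(y < q) cos (2 * pi * (k%:R * y%:R / q%:R)) = 0 :> R.
Proof.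
move=> qk; case: (posnP q) => [->|q0]; first by rewrite big_ord0.
have q0R : (q%:R : R) != 0 by rewrite pnatr_eq0 -lt0n.
pose r := (k %% q)%N; pose a : R := pi * r%:R / q%:R.
have r0 : (0 < r)%N by rewrite lt0n.
have rq : (r < q)%N by rewrite ltn_mod.
have sa : 0 < sin a.
  apply: sin_gt0_pi; rewrite /a divr_gt0 ?mulr_gt0 ?pi_gt0 ?ltr0n//=.
  by rewrite -mulrA gtr_pMr ?pi_gt0// ltr_pdivrMr ?ltr0n// mul1r ltr_nat.
pose f (y : nat) := sin (a *+ 2 * y%:R - a).
apply/eqP; rewrite -(mulrI_eq0 _ (x := 2 * sin a)); last first.
  by apply/lregP; rewrite mulf_neq0// ?pnatr_eq0// gt_eqF.
rewrite big_distrr /= (eq_bigr (fun y : 'I_q => f y.+1 - f y)); last first.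
  move=> y _; rewrite /f.
  have -> : 2 * pi * (k%:R * y%:R / q%:R) =
      a *+ 2 * y%:R + pi *+ 2 *+ ((k %/ q) * y) :> R.
    have -> : k%:R = (k %/ q)%:R * q%:R + r%:R :> R.
      by rewrite -natrM -natrD -divn_eq.
    rewrite /a -[_ *+ (_ * _)]mulr_natr natrM !mulr2n.
    move: (k %/ q)%:R (r%:R : R) (y%:R : R) (q%:R : R) q0R pi.
    by move=> *; field.
  rewrite (periodicn (@cosD2pi R)).
  have -> : a *+ 2 * y.+1%:R - a = a *+ 2 * y%:R + a.
    by rewrite -natr1 mulr2n; ring.
  by rewrite sinD sinB; ring.
rewrite -(big_mkord xpredT (fun y => f y.+1 - f y)) telescope_sumr// /f.
rewrite mulr0 sub0r.
have -> : a *+ 2 * q%:R - a = - a + pi *+ 2 *+ r.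
  rewrite /a -[pi *+ 2 *+ r]mulr_natr !mulr2n.
  by move: (r%:R : R) (q%:R : R) q0R pi => *; field.
by rewrite (periodicn (@sinD2pi R)) subrr.
Qed.

Let sum_wfun q b : \sum_(y < q) wfun q b y%:Z = q%:R * b 0%N.
Proof.
rewrite /wfun big_split /= sumr_const card_ord mulr_natl exchange_big /=.
rewrite [X in _ + X]big1 ?addr0// => j qj.
by rewrite -big_distrr -big_distrr /= sum_cos// !mulr0.
Qed.

Let fn_continuous n (a : 'I_n -> R) :
  continuous (fun v : 'rV[R]_n => \sum_i v ord0 i * a i).
Proof.
have cf i : continuous (fun v : 'rV[R]_n => v ord0 i * a i).
  move=> w; exact: (cvgM (@coord_continuous R 1 n ord0 i w) (cvg_cst _)).
by apply: continuous_big => [|i _]; [exact: add_continuous|exact: cf].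
Qed.

Let closed_preimage (U T : topologicalType) (f : U -> T) (D : set T) :
  continuous f -> closed D -> closed (f @^-1` D).
Proof. by move=> cf; move/continuous_closedP: cf; exact. Qed.

Lemma lambda_C0_min q : (0 < q)%N ->
  @witness_constant_terms R q (lambda_C0 R q) /\
  forall c, @witness_constant_terms R q c -> lambda_C0 R q <= c.
Proof.
case: q => [//|n] _; set q := n.+1.
pose W : 'M[R]_(q, q) := \matrix_(j, y)
  if j == ord0 then 1 else if ~~ (q %| j ^ 3)%N then kern q j (y : nat)%:Z else 0.
have WE (u : 'rV[R]_q) (y : 'I_q) :
    (u *m W) ord0 y = wfun q (fun j => u ord0 (inord j)) (y : nat)%:Z.
  rewrite mxE big_ord_recl /wfun mxE eqxx mulr1; congr (_ + _).
    by congr (u _ _); apply: val_inj; rewrite /= inordK.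
  rewrite big_add1 /= big_mkord [RHS]big_mkcond; apply: eq_bigr => i _.
  rewrite mxE /= /bump leq0n add1n.
  case: ifP => _; last by rewrite mulr0.
  by congr (u _ _ * _); apply: val_inj; rewrite /= inordK// ltnS.
pose M := cokermx W.
pose K := [set v : 'rV[R]_q | [/\ v *m M = 0, forall i, 0 <= v ord0 i,
  v ord0 ord0 = 1 & \sum_i v ord0 i * 1 <= q%:R]].
have Kw v : K v -> exists2 b, cubic_modular_witness q b (wfun q b) &
    \sum_i v ord0 i * 1 = q%:R * b 0%N.
  case=> vM v0 v1 _; have /submxP[u uE] : (v <= W)%MS by rewrite submxE vM.
  exists (fun j => u ord0 (inord j)).
    apply/witnessE; split=> // [y yq|].
      by rewrite -(WE u (Ordinal yq)) -uE.
    by rewrite -(WE u ord0) -uE.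
  rewrite -(sum_wfun q (fun j => u ord0 (inord j))).
  by apply: eq_bigr => i _; rewrite mulr1 uE WE.
have wK b g : cubic_modular_witness q b g -> b 0%N <= 1 ->
    exists2 v, K v & \sum_i v ord0 i * 1 = q%:R * b 0%N.
  move=> /witnessE[-> g0 g1] b1.
  pose u : 'rV[R]_q := \row_j b j.
  have uE (y : 'I_q) : (u *m W) ord0 y = wfun q b (y : nat)%:Z.
    rewrite WE /wfun mxE inordK//; congr (_ + _).
    rewrite big_nat_cond [RHS]big_nat_cond; apply: eq_bigr => j.
    by case/andP => /andP[_ jq] _; rewrite mxE inordK.
  have sE : \sum_i (u *m W) ord0 i * 1 = q%:R * b 0%N.
    by rewrite -sum_wfun; apply: eq_bigr => i _; rewrite mulr1 uE.
  exists (u *m W) => //; split.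
  - by rewrite -mulmxA mulmx_coker mulmx0.
  - by move=> i; rewrite uE g0.
  - by rewrite uE.
  - by rewrite sE ler_piMr.
have w1 : cubic_modular_witness q (fun j => (j == 0%N)%:R)
    (wfun q (fun j => (j == 0%N)%:R) : int -> R).
  have E y : wfun q (fun j => (j == 0%N)%:R) y = 1 :> R.
    rewrite /wfun eqxx big_nat_cond big1 ?addr0// => j.
    by case/andP => /andP[j0 _] _; rewrite gtn_eqF// mul0r.
  by apply/witnessE; split=> [//|y _|]; rewrite E.
have K0 : K !=set0 by have [//|v Kv _] := wK _ _ w1; exists v.
have cK : compact K.
  apply: bounded_closed_compact.
    exists q%:R; split; first exact: num_real.
    move=> x qx v [_ v0 _ vq]; rewrite /= [leLHS]/Num.Def.normr /= mx_normrE; apply: bigmax_le.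
      by apply/ltW/(le_lt_trans _ qx).
    move=> [i j] _ /=; rewrite (ord1 i) ger0_norm//.
    apply/ltW/(le_lt_trans _ qx)/(le_trans _ vq).
    rewrite (bigD1 j)//= mulr1 lerDl sumr_ge0// => k _.
    by rewrite mulr1.
  have -> : K = (\bigcap_(j in setT) [set v : 'rV[R]_q | \sum_i v ord0 i * M i j = 0])
      `&` (\bigcap_(i in setT) [set v : 'rV[R]_q | 0 <= v ord0 i])
      `&` [set v : 'rV[R]_q | v ord0 ord0 = 1]
      `&` [set v : 'rV[R]_q | \sum_i v ord0 i * 1 <= q%:R].
    apply/seteqP; split=> v.
      case=> vM v0 v1 vq; do !split=> //.
        by move=> j _ /=; move/matrixP/(_ ord0 j): vM; rewrite !mxE.
      by move=> i _ /=.
    case=> [[[vM v0] v1] vq]; split=> //; last by move=> i; exact: v0.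
    by apply/rowP => j; rewrite !mxE; apply: (vM j).
  apply: closedI; first apply: closedI; first apply: closedI.
  - apply: closed_bigI => j _.
    apply: (closed_preimage (f := (fun v : 'rV[R]_q => \sum_i v ord0 i * M i j)) _ (@closed_eq _ _)).
    exact: fn_continuous.
  - apply: closed_bigI => i _.
    apply: (closed_preimage (f := (fun v : 'rV[R]_q => v ord0 i)) _ (@closed_ge _ _)).
    exact: coord_continuous.
  - apply: (closed_preimage (f := (fun v : 'rV[R]_q => v ord0 ord0)) _ (@closed_eq _ _)).
    exact: coord_continuous.
  - apply: (closed_preimage (f := (fun v : 'rV[R]_q => \sum_i v ord0 i * 1)) _ (@closed_le _ _)).
    exact: fn_continuous.
have [|v /set_mem Kv vmin] := compact_EVT_min (f := fun v : 'rV[R]_q => \sum_i v ord0 i * 1) K0 cK.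
  by apply: continuous_subspaceT; exact: fn_continuous.
have [b wb bE] := Kw _ Kv.
have q0 : 0 < q%:R :> R by rewrite ltr0n.
have mem : @witness_constant_terms R q (b 0%N) by exists b, (wfun q b).
have lb c : @witness_constant_terms R q c -> b 0%N <= c.
  case=> b' [g [wg ->]]; have [b1|b1] := leP (b' 0%N) 1.
    have [v' Kv' E] := wK _ _ wg b1.
    by rewrite -(ler_pM2l q0) -bE -E vmin// mem_set.
  have [//|v1 Kv1 E] := wK _ _ w1.
  apply: le_trans (ltW b1).
  have := vmin _ (mem_set Kv1); rewrite E bE /= mulr1.
  by rewrite -[leRHS]mulr1 ler_pM2l.
suff -> : lambda_C0 R q = b 0%N by [].
apply/eqP; rewrite eq_le; apply/andP; split.
  by apply: ge_inf => //; exists (b 0%N).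
by apply: lb_le_inf => //; exists (b 0%N).
Qed.

End minimum.

(* Main.v *)
Require Import Defs.
From mathcomp Require Import all_boot all_order all_algebra.
From mathcomp Require Import all_classical all_reals all_analysis.
From mathcomp Require Import complex ring lra zify.
Import Order.TTheory GRing.Theory Num.Theory.
Local Open Scope ring_scope.

Set Implicit Arguments.
Unset Strict Implicit.
Unset Printing Implicit Defensive.

(** Put [s = 3 epsilon] and [lam p = p^(-s)].  Let [N] be the random profinite
    integer whose [p]-components are independent, equal to [p^v] times a
    Haar-distributed unit with probability [lam p ^ v (1 - lam p)].  The witness
    functions are [g_q(y) = E cos(2 pi N^3 y / q)], which depends on [y / q] only,
    and the constant term is [P(q | N^3)].  Both are multiplicative in [q].

    On prime powers, [P(p^K | N^3) = lam p ^ ceil(K / 3) <= p^(- epsilon K)].  For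
    [p] not dividing [y], splitting off [v = 0] gives
    [g_(p^(K+1))(y) = lam p * g_(p^K)(p^2 y) + (1 - lam p) * u], with [u] the mean
    of [cos(2 pi n^3 y / p^(K+1))] over units [n]; [u] vanishes for [K >= 1]
    ([K >= 2] if [p = 3]).  Nonnegativity thus reduces to
    [lam p + (1 - lam p) * u >= 0] for [K = 0].  There [u] is given by a cubic
    Gaussian period: it is [- 1 / (p - 1)] if [p = 2 (mod 3)], and in general the
    second moment over [y] yields [|sum_n cos(2 pi n^3 y / p)| <= 2 sqrt p], which
    is enough for [p >= 31].  The primes 7, 13 and 19 are settled by the minimal
    polynomials of their Gaussian periods; at 13 equality holds, which is where
    [epsilon] comes from. *)

(** * Trigonometric sums *)

Section trigonometric_sums.
Context {R : realType}.
Implicit Types (q n r : nat) (k l m a : int).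

Definition cosq q k : R := cos (2 * pi * (k%:~R / q%:R)).
Definition sinq q k : R := sin (2 * pi * (k%:~R / q%:R)).

Lemma cosq0 q : cosq q 0 = 1.
Proof. by rewrite /cosq mul0r mulr0 cos0. Qed.

Lemma cosqN q k : cosq q (- k) = cosq q k.
Proof. by rewrite /cosq mulrNz mulNr mulrN cosN. Qed.

Lemma sinqN q k : sinq q (- k) = - sinq q k.
Proof. by rewrite /sinq mulrNz mulNr mulrN sinN. Qed.

Lemma cosqD q k l : cosq q (k + l) = cosq q k * cosq q l - sinq q k * sinq q l.
Proof. by rewrite /cosq /sinq -cosD -mulrDr -mulrDl -intrD. Qed.

Lemma sinqD q k l : sinq q (k + l) = sinq q k * cosq q l + cosq q k * sinq q l.
Proof. by rewrite /cosq /sinq -sinD -mulrDr -mulrDl -intrD. Qed.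

Lemma cosqM q k l : cosq q k * cosq q l = (cosq q (k + l) + cosq q (k - l)) / 2.
Proof. rewrite !cosqD cosqN sinqN; lra. Qed.

Lemma cosq_geN1 q k : -1 <= cosq q k. Proof. exact: cos_geN1. Qed.

Lemma cosq_sinq_period q m : cosq q (m * q) = 1 /\ sinq q (m * q) = 0.
Proof.
have [->|q0] := posnP q; first by rewrite mulr0 cosq0 /sinq mul0r mulr0 sin0.
have E n : cosq q (n%:Z * q) = 1 /\ sinq q (n%:Z * q) = 0.
  rewrite /cosq /sinq intrM mulfK ?pnatr_eq0 -?lt0n// pmulrn.
  have -> : 2 * pi * n%:~R = 0 + pi *+ 2 *+ n :> R.
    by rewrite add0r -[RHS]mulr_natr mulr2n -pmulrn; ring.
  by rewrite (periodicn (@cosD2pi R)) (periodicn (@sinD2pi R)) cos0 sin0.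
case: m => n; first exact: E.
by rewrite NegzE mulNr cosqN sinqN (E n.+1).1 (E n.+1).2 oppr0.
Qed.

Lemma eq_cosq q k l : (k = l %[mod q])%Z -> cosq q k = cosq q l.
Proof.
suff E j : cosq q j = cosq q (j %% q)%Z by move=> kl; rewrite E kl -E.
rewrite {1}(divz_eq j q) cosqD.
by case: (cosq_sinq_period q (j %/ q)%Z) => -> ->; rewrite mul1r mul0r subr0.
Qed.

Lemma eq_sinq q k l : (k = l %[mod q])%Z -> sinq q k = sinq q l.
Proof.
suff E j : sinq q j = sinq q (j %% q)%Z by move=> kl; rewrite E kl -E.
rewrite {1}(divz_eq j q) sinqD.
by case: (cosq_sinq_period q (j %/ q)%Z) => -> ->; rewrite mul1r mul0r add0r.
Qed.

Lemma cosq_scale q r k : (0 < r)%N -> cosq (q * r) (k * r) = cosq q k.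
Proof.
move=> r0; rewrite /cosq intrM natrM -mulf_div divff ?mulr1// pnatr_eq0 -lt0n//.
Qed.

Lemma sinq_scale q r k : (0 < r)%N -> sinq (q * r) (k * r) = sinq q k.
Proof.
move=> r0; rewrite /sinq intrM natrM -mulf_div divff ?mulr1// pnatr_eq0 -lt0n//.
Qed.

(** Multiplying by [2 * sin h], with [h] half the phase increment, makes the sum telescope. Passing
    to the residue [r] of [k] puts [h] strictly between 0 and [pi], so that [sin h] is nonzero. *)
Lemma sum_cos_shift n k (x : R) : ~~ (n %| k)%Z ->
  \sum_(t < n) cos (x + 2 * pi * ((k * t%:Z)%:~R / n%:R)) = 0.
Proof.
move=> nk; have [->|n0] := posnP n; first by rewrite big_ord0.
pose r := absz (k %% n)%Z.
have rE : r%:Z = (k %% n)%Z by rewrite gez0_abs// modz_ge0// -lt0n.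
have r0 : (0 < r)%N.
  by rewrite absz_gt0; apply: contra nk => /eqP E; apply/dvdz_mod0P.
have rn : (r < n)%N by rewrite -ltz_nat rE ltz_pmod.
pose h : R := pi * r%:R / n%:R.
pose f (t : nat) := sin (x + 2 * pi * ((r%:Z * t%:Z)%:~R / n%:R) - h).
have sr : 0 < sin h.
  apply: sin_gt0_pi; rewrite divr_gt0 ?mulr_gt0 ?pi_gt0 ?ltr0n//=.
  by rewrite /h -mulrA gtr_pMr ?pi_gt0// ltr_pdivrMr ?ltr0n// mul1r ltr_nat.
have nR : (n%:R : R) != 0 by rewrite pnatr_eq0 -lt0n.
have step (t : 'I_n) :
    2 * sin h * cos (x + 2 * pi * ((k * t%:Z)%:~R / n%:R)) = f t.+1 - f t.
  have -> : cos (x + 2 * pi * ((k * t%:Z)%:~R / n%:R)) =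
      cos (x + 2 * pi * ((r%:Z * t%:Z)%:~R / n%:R)).
    have kr : (k * t%:Z = r%:Z * t%:Z %[mod n])%Z by rewrite rE modzMml.
    rewrite !cosD -/(cosq n (k * t%:Z)) -/(sinq n (k * t%:Z)).
    by rewrite (eq_cosq kr) (eq_sinq kr).
  have -> : f t.+1 = sin (x + 2 * pi * ((r%:Z * t%:Z)%:~R / n%:R) + h).
    by rewrite /f -[t.+1]addn1 PoszD !intrM intrD /h; congr sin; field.
  by rewrite /f sinD sinB; ring.
apply/eqP; rewrite -(mulrI_eq0 _ (x := 2 * sin h)); last first.
  by apply/lregP; rewrite mulf_neq0// ?pnatr_eq0// gt_eqF.
rewrite big_distrr /= (eq_bigr _ (fun t _ => step t)).
rewrite -(big_mkord xpredT (fun t => f t.+1 - f t)) telescope_sumr//.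
suff -> : f n = f 0%N by rewrite subrr.
rewrite /f -[RHS](periodicn (@sinD2pi R) r) !intrM -[_ *+ r]mulr_natr mulr2n mulr0.
by congr sin; field.
Qed.

Lemma sum_cosq n k : ~~ (n %| k)%Z -> \sum_(t < n) cosq n (k * t%:Z) = 0.
Proof.
move=> nk; rewrite -[RHS](sum_cos_shift 0 nk).
by apply: eq_bigr => t _; rewrite add0r.
Qed.

End trigonometric_sums.

(** * Cubic exponential sums over prime fields *)

Section cubic_sum_finite_field.
Context {R : realType} (F : finFieldType) (e : F -> R).
(** [e] stands for the real part of a nontrivial additive character of [F]: the hypotheses are its
    value at 0, the product formula of the cosine and orthogonality. *)
Hypothesis e0 : e 0 = 1.
Hypothesis eM : forall x y : F, e x * e y = (e (x + y) + e (x - y)) / 2.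
Hypothesis sum_e : forall k : F, k != 0 -> \sum_(y : F) e (k * y) = 0.

Let f (y : F) := \sum_(u : F) e (u ^+ 3 * y).

Lemma card_cube_fiber (a : F) : (#|[set u : F | u ^+ 3 == a]| <= 3)%N.
Proof.
have s4 : size ('X^3 - a%:P : {poly F}) = 4%N by rewrite size_XnsubC.
have n0 : 'X^3 - a%:P != 0 :> {poly F} by rewrite -size_poly_gt0 s4.
rewrite cardE -ltnS -[X in (_ < X)%N]s4; apply: max_poly_roots => //.
  apply/allP => u; rewrite mem_enum inE => /eqP uE.
  by rewrite /root !hornerE uE subrr.
exact: enum_uniq.
Qed.

Lemma cubic_sum_injective (y : F) : injective (fun u : F => u ^+ 3) -> y != 0 ->
  f y = 0.
Proof.
move=> inj y0; rewrite /f -[RHS](sum_e y0) [RHS](reindex_inj inj) /=.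
by apply: eq_bigr => u _; rewrite mulrC.
Qed.

Let sum_eE (k : F) : \sum_(y : F) e (k * y) = if k == 0 then #|F|%:R else 0.
Proof.
case: eqP => [->|/eqP]; last exact: sum_e.
by under eq_bigr do rewrite mul0r e0; rewrite sumr_const.
Qed.

Lemma cubic_sum_first_moment : \sum_(y : F) f y = #|F|%:R.
Proof.
rewrite /f exchange_big (bigD1 0) //= [X in _ + X]big1 => [|u u0].
  by rewrite sum_eE expr0n eqxx addr0.
by rewrite sum_eE expf_eq0 (negbTE u0).
Qed.

Let fiber_sum (a : F) : a != 0 -> \sum_(u : F) (u ^+ 3 == a)%:R <= 3 :> R.
Proof.
move=> a0; rewrite -natr_sum ler_nat; apply: leq_trans (card_cube_fiber a).
by rewrite -sum1dep_card [leqRHS]big_mkcond leq_sum// => u _; case: eqP.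
Qed.

Let fiber_sum0 : \sum_(u : F) (u ^+ 3 == 0)%:R = 1 :> R.
Proof.
rewrite (bigD1 0)//= expr0n eqxx big1 ?addr0// => u u0.
by rewrite expf_eq0 (negbTE u0).
Qed.

Let card_unit_sum : #|F|%:R - 1 = \sum_(u : F | u != 0) 1 :> R.
Proof. by have := sumr_const F (1 : R); rewrite (bigD1 0)//= => <-; ring. Qed.

(** By the product formula and orthogonality, the sum over [y] counts the pairs with [v ^+ 3] equal
    to [u ^+ 3] or to its opposite, with weight [#|F| / 2] each. A nonzero [u] has at most three
    partners for either sign. *)
Lemma cubic_sum_second_moment :
  \sum_(y : F) f y ^+ 2 <= #|F|%:R * (1 + 3 * (#|F|%:R - 1)).
Proof.
have -> : \sum_(y : F) f y ^+ 2 = \sum_(u : F) \sum_(v : F)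
    ((v ^+ 3 == - u ^+ 3)%:R + (v ^+ 3 == u ^+ 3)%:R) / 2 * #|F|%:R.
  have E (y : F) : f y ^+ 2 = \sum_(u : F) \sum_(v : F)
     (e ((u ^+ 3 + v ^+ 3) * y) + e ((u ^+ 3 - v ^+ 3) * y)) / 2.
    rewrite expr2 /f big_distrl; apply: eq_bigr => u _ /=.
    rewrite big_distrr; apply: eq_bigr => v _ /=.
    by rewrite eM -mulrDl -mulrBl.
  under eq_bigr do rewrite E.
  rewrite exchange_big; apply: eq_bigr => u _ /=.
  rewrite exchange_big; apply: eq_bigr => v _ /=.
  rewrite -mulr_suml big_split !sum_eE /= -[v ^+ 3 == - _]addr_eq0 addrC.
  rewrite [v ^+ 3 + _]addrC subr_eq0 [u ^+ 3 == _]eq_sym.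
  by case: ifP => _; case: ifP => _; rewrite /=; ring.
rewrite card_unit_sum (bigD1 0)//= mulrDr mulr1; apply: lerD.
  rewrite -mulr_suml -mulr_suml big_split /= expr0n oppr0 fiber_sum0.
  by rewrite (_ : (1 + 1) / 2 = 1) ?mul1r//; field.
rewrite mulrA mulr_sumr; apply: ler_sum => u u0.
rewrite -mulr_suml mulr1 [leRHS]mulrC ler_wpM2r// -mulr_suml big_split /=.
have u3 : u ^+ 3 != 0 by rewrite expf_eq0.
have := fiber_sum u3; have : - u ^+ 3 != 0 by rewrite oppr_eq0.
by move/fiber_sum; lra.
Qed.

(* [f] is constant on the coset [A] of nonzero cubes times [y], which contains
   at least a third of the nonzero elements; since the values of [f] off [0]
   add up to [0], the rest of the second moment is at least half of the share
   of [A]. *)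
Lemma cubic_sum_sqr_le (y : F) : y != 0 -> f y ^+ 2 <= 4 * #|F|%:R.
Proof.
move=> y0; pose A := [set y * c ^+ 3 | c : F & c != 0].
have fA z : z \in A -> f z = f y.
  case/imsetP => c; rewrite inE => c0 ->.
  rewrite /f [RHS](reindex_inj (mulIf c0)) /=.
  by apply: eq_bigr => u _; rewrite exprMn; congr e; ring.
have A0 z : z \in A -> z != 0.
  by case/imsetP => c; rewrite inE => c0 ->; rewrite mulf_neq0// expf_neq0.
set N : R := #|F|%:R; set a : R := #|A|%:R.
have aE : a = \sum_(z in A) 1 by rewrite sumr_const.
have NE : N - 1 = \sum_(z : F | z != 0) 1 := card_unit_sum.
(* The map [c -> y * c ^+ 3] sends the nonzero elements onto [A], with fibers of size at most 3. *)
have cA : N - 1 <= 3 * a.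
  rewrite NE (partition_big (fun c => y * c ^+ 3) (mem A)) /=; last first.
    by move=> c c0; apply/imsetP; exists c; rewrite ?inE.
  rewrite aE mulr_sumr; apply: ler_sum => z zA; rewrite mulr1.
  have z0 : z / y != 0 by rewrite mulf_neq0 ?invr_eq0// A0.
  apply: le_trans (fiber_sum z0); rewrite big_mkcond; apply: ler_sum => c _.
  case: ifP => // /andP[_ /eqP <-].
  by rewrite mulrAC divff// mul1r eqxx.
have split_sum (h : F -> R) : \sum_z h z =
    h 0 + (\sum_(z in A) h z + \sum_(z | (z != 0) && (z \notin A)) h z).
  rewrite (bigD1 0)//= (bigID (mem A))/=; congr (_ + (_ + _)).
  by apply: eq_bigl => z; case: (boolP (z \in A)) => [/A0->|]; rewrite ?andbF.
have f0 : f 0 = N.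
  by rewrite /f; under eq_bigr do rewrite mulr0 e0; rewrite sumr_const.
set B := fun z => (z != 0) && (z \notin A).
have bE : \sum_(z | B z) 1 = N - 1 - a :> R.
  have := split_sum (fun=> 1); rewrite sumr_const -/N -aE => ->; ring.
have m1 : \sum_(z | B z) f z = - (a * f y).
  have := split_sum f; rewrite cubic_sum_first_moment f0 -/N.
  rewrite (eq_bigr _ fA) sumr_const -[f y *+ _]mulr_natl -/a -/B; lra.
have m2 : a * f y ^+ 2 + \sum_(z | B z) f z ^+ 2 <= 2 * N * (N - 1).
  have := cubic_sum_second_moment; rewrite split_sum f0 -/N.
  rewrite (eq_bigr (fun=> f y ^+ 2)) => [|z /fA->//].
  by rewrite sumr_const -[f y ^+ 2 *+ _]mulr_natl -/a -/B; lra.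
(* If [a] were exactly [(N - 1) / 3], the mean of [f] over [B] would be [- f y / 2]; hence this
   choice of square. Expanding it bounds the second moment over [B] from below. *)
have : 0 <= \sum_(z | B z) (f z + f y / 2) ^+ 2.
  by apply: sumr_ge0 => z _; exact: sqr_ge0.
under eq_bigr do rewrite sqrrD.
rewrite !big_split /=.
have -> : \sum_(z | B z) f z * (f y / 2) = - (a * f y ^+ 2) / 2.
  by rewrite -mulr_suml m1; lra.
have -> : \sum_(z | B z) (f y / 2) ^+ 2 = (N - 1 - a) * (f y / 2) ^+ 2.
  by rewrite -bE mulr_suml; apply: eq_bigr => z _; rewrite mul1r.
have N1 : 0 < N - 1.
  by rewrite subr_gt0 ltr1n card_finNzRing_gt1.
move=> H; rewrite -(ler_pM2r N1).
have := sqr_ge0 (f y); nra.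
Qed.

End cubic_sum_finite_field.

(** * Cubic sums modulo a prime *)

Section cubic_sum_prime.
Context {R : realType}.
Implicit Types (p n m : nat) (y z : int).

Definition cubic_sum p y : R := \sum_(u < p) cosq p ((u ^ 3)%N%:Z * y).

Lemma eq_cubic_sum p y z : (y = z %[mod p])%Z -> cubic_sum p y = cubic_sum p z.
Proof.
by move=> yz; apply: eq_bigr => u _; apply: eq_cosq; rewrite -modzMmr yz modzMmr.
Qed.

Section prime_field.
Variables (p : nat) (p_pr : prime p).
Let e (x : 'F_p) : R := cosq p (x : nat)%:Z.

Let eE n : e n%:R = cosq p n%:Z.
Proof. by apply: eq_cosq; rewrite val_Fp_nat// !modz_nat modn_mod. Qed.

Let sum_Fp (h : nat -> R) : \sum_(x : 'F_p) h x = \sum_(i < p) h i.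
Proof. by rewrite -(big_mkord xpredT h) Fp_cast// big_mkord. Qed.

Let e0 : e 0 = 1. Proof. exact: cosq0. Qed.

Let eM (x y : 'F_p) : e x * e y = (e (x + y) + e (x - y)) / 2.
Proof.
rewrite -[x]natr_Zp -[y]natr_Zp -natrD.
have yp : (y <= p)%N by rewrite -[X in (_ <= X)%N](Fp_cast p_pr) ltnW.
have -> : (x%:R - y%:R : 'F_p) = (x + (p - y))%:R.
  by rewrite natrD natrB// pchar_Fp_0// sub0r.
rewrite !eE cosqM PoszD; congr ((_ + _) / 2); apply: eq_cosq.
by rewrite PoszD -subzn// addrCA modzDl.
Qed.

Let natr_Fp_eq0 n : ((n%:R : 'F_p) == 0) = (p %| n)%N.
Proof. by rewrite -val_eqE /= val_Fp_nat. Qed.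

Let sum_e (k : 'F_p) : k != 0 -> \sum_(y : 'F_p) e (k * y) = 0.
Proof.
rewrite -[k]natr_Zp natr_Fp_eq0 => pk.
transitivity (\sum_(y : 'F_p) cosq p ((k : nat)%:Z * (y : nat)%:Z) : R).
  by apply: eq_bigr => y _; rewrite -[y in LHS]natr_Zp -natrM eE PoszM.
by rewrite (sum_Fp (fun i => cosq p ((k : nat)%:Z * i%:Z))) sum_cosq.
Qed.

Let cubic_sumE n : cubic_sum p n = \sum_(u : 'F_p) e (u ^+ 3 * n%:R).
Proof.
rewrite /cubic_sum -(sum_Fp (fun u => cosq p ((u ^ 3)%N%:Z * n))).
by apply: eq_bigr => u _; rewrite -[in RHS](natr_Zp u) -natrX -natrM eE PoszM.
Qed.

Let modp_neq0 y : ~~ (p %| y)%Z ->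
  cubic_sum p y = cubic_sum p `|(y %% p)%Z|%N /\ (`|(y %% p)%Z|%:R : 'F_p) != 0.
Proof.
have p0 : (p%:Z != 0) by rewrite eqz_nat -lt0n prime_gt0.
have rE : `|(y %% p)%Z|%N%:Z = (y %% p)%Z by rewrite gez0_abs// modz_ge0.
move=> py; split; first by apply: eq_cubic_sum; rewrite rE modz_mod.
rewrite natr_Fp_eq0; apply: contra py => pr; apply/dvdz_mod0P.
by have /dvdz_mod0P : (p %| (y %% p)%Z)%Z := pr; rewrite modz_mod.
Qed.

Lemma cubic_sum_sqr_le_4p y : ~~ (p %| y)%Z -> cubic_sum p y ^+ 2 <= 4 * p%:R.
Proof.
case/modp_neq0 => -> ?; rewrite cubic_sumE.
by have := cubic_sum_sqr_le e0 eM sum_e; rewrite card_Fp//; exact.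
Qed.

Lemma cubic_sum_eq0 y : (p %% 3 = 2)%N -> ~~ (p %| y)%Z -> cubic_sum p y = 0.
Proof.
move=> p3 /modp_neq0[-> y0]; rewrite cubic_sumE.
apply: cubic_sum_injective => // u v uv.
have Fermat (x : 'F_p) : x ^+ p = x.
  by rewrite -[x]natr_Zp -natrX -Fp_nat_mod// fermat_little// Fp_nat_mod.
have E (x : 'F_p) : x = (x ^+ 3) ^+ ((p %/ 3).*2.+1).
  rewrite -exprM (_ : (3 * _ = p + p.-1)%N); last first.
    by have := divn_eq p 3; rewrite p3; lia.
  by rewrite exprD Fermat -exprS prednK ?Fermat// prime_gt0.
by rewrite (E u) (E v) uv.
Qed.

End prime_field.

Lemma cubic_sumN1 p y : prime p -> cubic_sum p y - 1 =
  \sum_(u < p | ~~ (p %| u)%N) cosq p ((u ^ 3)%N%:Z * y).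
Proof.
case: p => // p p_pr; rewrite /cubic_sum (bigD1 ord0)//= mul0r cosq0.
rewrite [1 + _]addrC addrK; apply: eq_bigl => u.
by rewrite -val_eqE /= /dvdn modn_small.
Qed.

(** * Cubic Gaussian periods modulo 7, 13 and 19 *)

Section gaussian_periods.
Variables (p : nat) (y : int).
Hypothesis py : ~~ (p %| y)%Z.
Let c n : R := cosq p (n%:Z * y).

Let c0 : c 0%N = 1. Proof. by rewrite /c mul0r cosq0. Qed.

Let eq_c m n : (m == n %[mod p])%N || (p %| m + n)%N -> c m = c n.
Proof.
case/orP => [/eqP mn|/dvdnP[k mn]].
  by apply: eq_cosq; rewrite -modzMml modz_nat mn -modz_nat modzMml.
rewrite /c -(cosqN _ (n%:Z * y)); apply: eq_cosq.
have -> : m%:Z * y = k%:Z * y * p%:Z - n%:Z * y.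
  have -> : m%:Z = k%:Z * p%:Z - n%:Z by rewrite -PoszM -mn PoszD addrK.
  by ring.
by rewrite modzMDl.
Qed.

(** The representative of [n] up to sign modulo [p], at most [p / 2]. As [c] is even and periodic,
    sums and products of its values reduce to computations on these representatives. *)
Let red n := minn (n %% p) (p - n %% p).

Let c_red n : (0 < p)%N -> c n = c (red n).
Proof.
move=> p0; apply: eq_c; rewrite /red minnE.
have [le|lt] := leqP (n %% p) (p - n %% p).
  by rewrite (eqP le) subn0 modn_mod eqxx.
rewrite subKn 1?ltnW//; apply/orP; right.
rewrite {1}(divn_eq n p) -addnA subnKC; last by rewrite ltnW// ltn_pmod.
by rewrite dvdn_addr ?dvdn_mull.
Qed.

Let cM m n k : (0 < p)%N -> (n <= m)%N && (red (m + n) == k) ->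
  c m * c n = (c k + c (m - n)%N) / 2.
Proof.
move=> p0 /andP[nm /eqP <-].
by rewrite cosqM -mulrDl -mulrBl -PoszD subzn// -/(c _) c_red.
Qed.

Let sum_red (h : nat -> nat) : (0 < p)%N ->
  \sum_(t < p) c (h t) = \sum_(i <- [seq red (h t) | t <- iota 0 p]) c i.
Proof.
move=> p0; rewrite big_map -[in RHS](subn0 p) -/(index_iota 0 p) big_mkord.
by apply: eq_bigr => t _; rewrite c_red.
Qed.

Let sum_c : (0 < p)%N -> \sum_(i <- [seq red t | t <- iota 0 p]) c i = 0.
Proof.
move=> p0; rewrite -sum_red// -[RHS](sum_cosq py).
by apply: eq_bigr => t _; rewrite mulrC.
Qed.

Let cubic_sum_red : (0 < p)%N ->
  cubic_sum p y = \sum_(i <- [seq red (t ^ 3) | t <- iota 0 p]) c i.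
Proof. by move=> p0; rewrite -sum_red. Qed.

(** The nonzero cubes modulo 7 are 1 and -1, so the quotient is [c 1], a root of
    [8 x^3 + 4 x^2 - 4 x - 1], and this polynomial is negative below [- 95 / 100]. *)
Lemma cubic_sum7 : p = 7%N -> - 95 / 100 <= (cubic_sum p y - 1) / 6.
Proof.
move=> p7; have p0 : (0 < p)%N by rewrite p7.
have S1 : [seq red t | t <- iota 0 p] = [:: 0; 1; 2; 3; 3; 2; 1]%N.
  by rewrite /red p7.
have S3 : [seq red (t ^ 3) | t <- iota 0 p] = [:: 0; 1; 1; 1; 1; 1; 1]%N.
  by rewrite /red p7.
have M m n k : (n <= m)%N && (minn ((m + n) %% 7) (7 - (m + n) %% 7) == k) ->
  c m * c n = (c k + c (m - n)%N) / 2 by rewrite -p7; exact: cM.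
rewrite cubic_sum_red// S3; have := sum_c p0; rewrite S1.
rewrite !big_cons !big_nil c0 => S0.
have := M 1%N 1%N 2%N isT; have := M 2%N 1%N 3%N isT.
rewrite !subn1 /= c0 => h21 h11.
rewrite leNgt; apply/negP => h.
have h2 : c 2 = 2 * c 1 ^+ 2 - 1 by lra.
have h3 : c 3 = 2 * c 2 * c 1 - c 1 by lra.
move: S0; rewrite h3 h2.
nra.
Qed.

Lemma cubic_sum13E : p = 13%N ->
  cubic_sum p y = 1 + 6 * (cosq p y + cosq p (5 * y)).
Proof.
move=> p13; have p0 : (0 < p)%N by rewrite p13.
have S3 : [seq red (t ^ 3) | t <- iota 0 p] =
    [:: 0; 1; 5; 1; 1; 5; 5; 5; 5; 1; 1; 5; 1]%N by rewrite /red p13.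
rewrite cubic_sum_red// S3 !big_cons !big_nil c0 -[X in cosq p X + _]mul1r.
by rewrite -/(c 1) -/(c 5); ring.
Qed.

(* [x^3 + x^2 - 4 x + 1] is the minimal polynomial of the cubic Gaussian
   periods modulo 13. *)
Lemma cubic_sum13_root : p = 13%N ->
  let x := (cubic_sum p y - 1) / 3 in x ^+ 3 + x ^+ 2 - 4 * x + 1 = 0.
Proof.
move=> p13; rewrite cubic_sum13E//; have p0 : (0 < p)%N by rewrite p13.
have S1 : [seq red t | t <- iota 0 p] =
    [:: 0; 1; 2; 3; 4; 5; 6; 6; 5; 4; 3; 2; 1]%N by rewrite /red p13.
have M m n k : (n <= m)%N && (minn ((m + n) %% 13) (13 - (m + n) %% 13) == k) ->
  c m * c n = (c k + c (m - n)%N) / 2 by rewrite -p13; exact: cM.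
have := sum_c p0; rewrite S1 !big_cons !big_nil c0 => S0.
have := (M 1 1 2 isT, M 5 5 3 isT, M 5 1 6 isT)%N.
have := (M 2 2 4 isT, M 3 3 6 isT, M 3 2 5 isT)%N.
have := (M 4 4 5 isT, M 6 6 1 isT, M 6 4 3 isT)%N.
rewrite /subn /= !c0 => -[[m44 m66] m64] [[m22 m33] m32] [[m11 m55] m51].
rewrite -[X in cosq p X + _]mul1r -/(c 1) -/(c 5).
set x := (_ - 1) / 3.
(* The other two periods, over the cosets of 2 and 4 modulo the cubes. *)
pose x1 := 2 * (c 2 + c 3); pose x2 := 2 * (c 4 + c 6).
have xE : x = 2 * (c 1 + c 5) by rewrite /x; lra.
have S : x + x1 + x2 = -1 by rewrite xE /x1 /x2; lra.
have q0 : x ^+ 2 = 4 + x1 + 2 * x2 by rewrite xE /x1 /x2; lra.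
have q1 : x1 ^+ 2 = 4 + x2 + 2 * x by rewrite xE /x1 /x2; lra.
have q2 : x2 ^+ 2 = 4 + x + 2 * x1 by rewrite xE /x1 /x2; lra.
move: S q0 q1 q2; move: x x1 x2 {xE} => x x1 x2 S q0 q1 q2.
have x2E : x2 = x ^+ 2 + x - 3 by lra.
have x1E : x1 = 2 - 2 * x - x ^+ 2 by lra.
(* Both relations become quartics in [x] with the same leading term; half their difference is the
   cubic. *)
by move: q1 q2; rewrite x2E x1E; lra.
Qed.

(** The nonzero cubes modulo 19 are 1, 7, 8 and their opposites. Eliminating the other two periods
    shows that the period [x] is a root of [x^4 - 7 x^2 - x + 7]; this quartic, [x - 1] times the
    minimal polynomial, is positive for [x < -3]. *)
Lemma cubic_sum19 : p = 19%N -> - 303 / 600 <= (cubic_sum p y - 1) / 18.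
Proof.
move=> p19; have p0 : (0 < p)%N by rewrite p19.
have S1 : [seq red t | t <- iota 0 p] =
    [:: 0; 1; 2; 3; 4; 5; 6; 7; 8; 9; 9; 8; 7; 6; 5; 4; 3; 2; 1]%N.
  by rewrite /red p19.
have S3 : [seq red (t ^ 3) | t <- iota 0 p] =
    [:: 0; 1; 8; 8; 7; 8; 7; 1; 1; 7; 7; 1; 1; 7; 8; 7; 8; 8; 1]%N.
  by rewrite /red p19.
have M m n k : (n <= m)%N && (minn ((m + n) %% 19) (19 - (m + n) %% 19) == k) ->
  c m * c n = (c k + c (m - n)%N) / 2 by rewrite -p19; exact: cM.
rewrite cubic_sum_red// S3; have := sum_c p0; rewrite S1.
rewrite !big_cons !big_nil c0 => S0.
have := (M 1 1 2 isT, M 7 7 5 isT, M 8 8 3 isT)%N.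
have := (M 7 1 8 isT, M 8 1 9 isT, M 8 7 4 isT)%N.
have := (M 2 2 4 isT, M 5 5 9 isT, M 3 3 6 isT)%N.
have := (M 5 2 7 isT, M 3 2 5 isT, M 5 3 8 isT)%N.
rewrite /subn /= !c0.
move=> [[m52 m32] m53] [[m22 m55] m33] [[m71 m81] m87] [[m11 m77] m88].
pose x := 2 * (c 1 + c 7 + c 8); pose x1 := 2 * (c 2 + c 5 + c 3).
pose x2 := 2 * (c 4 + c 9 + c 6).
have S : x + x1 + x2 = -1 by rewrite /x /x1 /x2; lra.
have q0 : x ^+ 2 = 6 + x1 + 2 * x + 2 * x2 by rewrite /x /x1 /x2; lra.
have q1 : x1 ^+ 2 = 6 + x2 + 2 * x1 + 2 * x by rewrite /x /x1 /x2; lra.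
suff : - 303 / 100 <= x by rewrite /x; lra.
move: S q0 q1; move: x x1 x2 => x x1 x2 S q0 q1.
have x2E : x2 = x ^+ 2 - x - 5 by lra.
have x1E : x1 = 4 - x ^+ 2 by lra.
move: q1; rewrite x2E x1E => q1.
rewrite leNgt; apply/negP => h.
have x9 : 9 < x ^+ 2 by rewrite -(sqrrN x) (_ : 9 = 3 ^+ 2) ?ltr_pXn2r ?nnegrE//; lra.
have : 0 <= (x ^+ 2 - 9) * (x ^+ 2) by rewrite mulr_ge0 ?sqr_ge0 ?subr_ge0 ?ltW.
move: q1; rewrite sqrrB -exprM; lra.
Qed.

End gaussian_periods.
End cubic_sum_prime.

(** * The exponent and positivity modulo primes *)

Section exponent.
Context {R : realType}.
Let c13 : R := cos (pi / 13) + sin (3 * pi / 26).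
Let L13 : R := 1 - 2 / (2 + c13).

Definition sigma13 : R := 3 * epsilon13 R.

(** The constant that defines [epsilon13] comes from the Gaussian period modulo 13 at [y = 4], so
    [-2 * c13] is a root of the cubic of [cubic_sum13_root]. *)
Let c13E : (@cubic_sum R 13%N 4 - 1) / 3 = - 2 * c13.
Proof.
rewrite cubic_sum13E// /cosq /c13.
have -> : 2 * pi * ((5 * 4 : int)%:~R / 13) = pi / 13 + pi + pi *+ 2 :> R.
  by rewrite mulr2n; field.
have -> : 2 * pi * ((4 : int)%:~R / 13) = 3 * pi / 26 + pi / 2 :> R by field.
by rewrite cosD2pi cosDpi cosDpihalf; field.
Qed.

(* The bound 29/22 makes [lam 13 >= 29/73], just enough for [sigma13_le]. *)
Let c13_ge : 29 / 22 <= c13.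
Proof.
have c0 : 0 <= c13.
  have p0 := @pi_gt0 R.
  by rewrite addr_ge0 ?cos_ge0_pihalf ?sin_ge0_pi//; apply/andP; split; lra.
have := @cubic_sum13_root R 13%N 4 isT erefl; rewrite /= c13E => H.
rewrite leNgt; apply/negP => lt.
set x := -2 * c13 in H.
have x0 : x <= 0 by rewrite /x; lra.
have x1 : 0 <= x + 29 / 11 by rewrite /x; lra.
(* The product is [x ^+ 3 + x ^+ 2 - 4 * x + 1102 / 1331], which [H] makes negative. *)
have : 0 <= (x + 29 / 11) * (x ^+ 2 - 18 / 11 * x + 38 / 121).
  by apply: mulr_ge0 x1 _; have := sqr_ge0 x; lra.
by lra.
Qed.

Let L13E : L13 = c13 / (2 + c13).
Proof. by rewrite /L13; field; apply: lt0r_neq0; have := c13_ge; lra. Qed.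

Let L13_gt0 : 0 < L13.
Proof. by rewrite L13E divr_gt0//; have := c13_ge; lra. Qed.

Let L13_lt1 : L13 < 1.
Proof. by rewrite gtrBl divr_gt0//; have := c13_ge; lra. Qed.

Let L13_ge : 29 / 73 <= L13.
Proof. by rewrite L13E ler_pdivlMr; have := c13_ge; lra. Qed.

Let ln13_gt0 : 0 < ln 13 :> R. Proof. by rewrite ln_gt0// ltr1n. Qed.

Let sigma13E : sigma13 = - ln L13 / ln 13.
Proof.
rewrite /sigma13 /epsilon13 -addrA -/c13 -/L13; field.
by rewrite gt_eqF.
Qed.

Lemma sigma13_gt0 : 0 < sigma13.
Proof. by rewrite sigma13E divr_gt0// oppr_gt0 ln_lt0// L13_gt0 L13_lt1. Qed.

(** Equivalent to [1 <= L13 ^+ 25 * 13 ^+ 9], which barely holds at [29 / 73]. The rational exponent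
    lets bounds on [lam] be checked with integer powers. *)
Lemma sigma13_le : sigma13 <= 9 / 25.
Proof.
rewrite sigma13E ler_pdivrMr//.
have : 0 <= ln (L13 ^+ 25 * 13 ^+ 9).
  rewrite ln_ge0//; apply: le_trans (ler_wpM2r _ (lerXn2r 25 _ _ L13_ge)).
  - lra.
  - by rewrite exprn_ge0.
  - by rewrite nnegrE; lra.
  - by rewrite nnegrE ltW.
rewrite lnM ?posrE ?exprn_gt0// !lnXn//; lra.
Qed.

Definition lam (n : nat) : R := n%:R `^ (- sigma13).

Let lam13 : lam 13%N = L13.
Proof.
rewrite /lam /powR pnatr_eq0 /= sigma13E.
have -> : - (- ln L13 / ln 13) * ln 13 = ln L13 by field; rewrite gt_eqF.
by rewrite lnK ?posrE.
Qed.

Lemma lam_ge (n : nat) (r : R) : (0 < n)%N -> 0 < r -> r ^+ 25 * n%:R ^+ 9 <= 1 ->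
  r <= lam n.
Proof.
move=> n0 r0 rn; have nR : 0 < n%:R :> R by rewrite ltr0n.
have : ln (r ^+ 25 * n%:R ^+ 9) <= 0 by rewrite -ln1 ler_ln ?posrE ?mulr_gt0 ?exprn_gt0.
rewrite lnM ?posrE ?exprn_gt0// !lnXn// => h.
rewrite /lam /powR gt_eqF// -{1}(lnK r0) ler_expR.
have l0 : 0 <= ln n%:R :> R by rewrite ln_ge0// ler1n.
have := ler_wpM2r l0 sigma13_le; lra.
Qed.

Lemma lam_le1 (n : nat) : (0 < n)%N -> lam n <= 1.
Proof.
move=> n0; rewrite -(powRr0 n%:R); apply: ler_powR; first by rewrite ler1n.
by rewrite oppr_le0 ltW ?sigma13_gt0.
Qed.

Let powR_6_le : 6 `^ (18 / 25) <= 91 / 25 :> R.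
Proof.
have e0 : 0 <= 6 `^ (18 / 25) :> R := powR_ge0 _ _.
have E : (6 `^ (18 / 25)) ^+ 25 = 6 ^+ 18 :> R.
  by rewrite -powR_mulrn// -powRrM divfK ?pnatr_eq0// powR_mulrn.
rewrite -(ler_pXn2r (n := 25%N)) ?nnegrE//.
by rewrite E; lra.
Qed.

(** Young's inequality for [x / 6] and 1, with weights [18 / 25] and [7 / 25]; it is applied to the
    square root of a prime. *)
Let young (x : R) : 0 <= x -> x `^ (18 / 25) <= 91 / 25 * (7 / 25 + 3 / 25 * x).
Proof.
move=> x0; have x6 : 0 <= x / 6 by rewrite divr_ge0.
have Y : (x / 6) `^ (18 / 25) <= 7 / 25 + 3 / 25 * x.
  have := @conjugate_powR R ((x / 6) `^ (18 / 25)) 1 (25 / 18) (25 / 7)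
    (powR_ge0 _ _) ler01.
  rewrite mulr1 powR1 -powRrM (_ : 18 / 25 * (25 / 18) = 1); last by field.
  rewrite powRr1// => /(_ _ _ _) H; apply: le_trans (H _ _ _) _.
  - lra.
  - lra.
  - by rewrite !invfM !invrK; field.
  - by rewrite !invfM !invrK; lra.
rewrite -[x in leLHS](divfK (x := 6)) ?pnatr_eq0// powRM// mulrC.
by apply: ler_pM; rewrite ?powR_ge0.
Qed.

(* With [z] the square root of [p], [x >= - (1 + 2 z) / (z^2 - 1)], and Young's
   inequality bounds [p `^ (9 / 25)] by a linear function of [z], tangent at
   [z = 6] up to rounding. *)
Lemma local_positivity_large (p : nat) (x : R) : 31 <= p%:R :> R ->
  (1 + x * (p%:R - 1)) ^+ 2 <= 4 * p%:R -> 0 <= lam p + (1 - lam p) * x.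
Proof.
set z := Num.sqrt (p%:R : R) => p31.
have z2 : z ^+ 2 = p%:R by rewrite sqr_sqrtr.
have z0 : 0 <= z by rewrite sqrtr_ge0.
have z5 : 11 / 2 <= z.
  rewrite -(ler_pXn2r (n := 2%N)) ?nnegrE//.
  by rewrite z2; lra.
rewrite -z2 -(_ : (2 * z) ^+ 2 = 4 * z ^+ 2); last by ring.
rewrite -[leLHS]real_normK ?num_real// ler_pXn2r ?nnegrE ?mulr_ge0//.
rewrite ler_norml => /andP[xz _].
have p0 : (0 < p)%N by rewrite -(ltr0n R); lra.
have l1 := lam_le1 p0.
have l0 : 0 < lam p by apply: powR_gt0; rewrite ltr0n.
have [x0|x0] := leP 0 x.
  by apply: addr_ge0 (ltW l0) (mulr_ge0 _ x0); rewrite subr_ge0.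
have lD : 1 <= lam p * (91 / 25 * (7 / 25 + 3 / 25 * z)).
  apply: (@le_trans _ _ (lam p * z `^ (18 / 25))); last first.
    by apply: ler_wpM2l (ltW l0) _ _ (young z0).
  have -> : z `^ (18 / 25) = p%:R `^ (9 / 25).
    by rewrite /z -powR12_sqrt// -powRrM; congr (_ `^ _); field.
  rewrite /lam -powRD; last by rewrite pnatr_eq0 -lt0n p0 implybT.
  rewrite -[leLHS](powRr0 p%:R); apply: ler_powR; first by rewrite ler1n.
  by have := sigma13_le; lra.
(* Subtracting [1 + 2 * z] turns this into [(1 + 2 * z) * (D - 1) <= z ^+ 2 - 1], with [D] the
   linear bound. It holds from about [z = 5.29] on. *)
have zz : (1 + 2 * z) * (91 / 25 * (7 / 25 + 3 / 25 * z)) <= z ^+ 2 + 2 * z.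
  by nra.
have zp : 0 < z ^+ 2 - 1 by rewrite z2; lra.
have x1 : - x * (z ^+ 2 - 1) <= 1 + 2 * z by lra.
have D0 : 0 <= 91 / 25 * (7 / 25 + 3 / 25 * z) by lra.
set D := 91 / 25 * (7 / 25 + 3 / 25 * z) in lD zz D0.
(* Since [1 <= lam p * D], the factor [1 - lam p] is at most [lam p * (D - 1)]. *)
suff : - x * (D - 1) <= 1.
  move=> xD; have : - x * (1 - lam p) <= lam p; last lra.
  have := ler_wpM2l (ltW l0) xD; rewrite mulr1; apply: le_trans.
  by rewrite mulrCA; apply: ler_wpM2l; [lra|rewrite mulrBr; lra].
rewrite -(ler_pM2r zp) mul1r.
have D1 : 0 <= D - 1 by rewrite /D; lra.
have := ler_wpM2r D1 x1; lra.
Qed.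

Lemma local_positivity (p : nat) (y : int) : prime p -> ~~ (p %| y)%Z ->
  0 <= lam p + (1 - lam p) * ((cubic_sum p y - 1) / (p%:R - 1)).
Proof.
move=> p_pr py; have p0 := prime_gt0 p_pr.
have p1 : 0 < p%:R - 1 :> R by rewrite subr_gt0 ltr1n prime_gt1.
have [p31|p31] := leqP 31 p.
  apply: local_positivity_large; first by rewrite (ler_nat R 31).
  by rewrite divfK ?gt_eqF// addrC subrK cubic_sum_sqr_le_4p.
have l1 := lam_le1 p0.
(* The expression is nondecreasing in the mean and, at a mean [t <= 1], in [lam p]; so rational
   lower bounds [r] for [lam p] and [t] for the mean suffice. *)
have key (r t : R) : 0 < r -> r ^+ 25 * p%:R ^+ 9 <= 1 -> t <= 1 ->
    0 <= r + (1 - r) * t -> t <= (cubic_sum p y - 1) / (p%:R - 1) ->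
    0 <= lam p + (1 - lam p) * ((cubic_sum p y - 1) / (p%:R - 1)).
  move=> r0 rp t1 rt tx; have rl := lam_ge p0 r0 rp.
  apply: (@le_trans _ _ (lam p + (1 - lam p) * t)); last first.
    by rewrite lerD2l; apply: ler_wpM2l => //; rewrite subr_ge0.
  have : 0 <= (lam p - r) * (1 - t) by rewrite mulr_ge0 ?subr_ge0.
  lra.
have [p3|p3] := eqVneq (p %% 3)%N 2%N.
  (* The cubic sum vanishes, so the mean is [- 1 / (p - 1)], and [r = 1 / p] makes [r + (1 - r) * t]
     exactly 0. *)
  apply: (key p%:R^-1 (- (p%:R - 1)^-1)).
  - by rewrite invr_gt0 ltr0n.
  - rewrite exprVn mulrC ler_pdivrMr ?exprn_gt0 ?ltr0n// mul1r.
    by rewrite ler_eXn2l// ltr1n prime_gt1.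
  - by apply: (@le_trans _ _ 0); rewrite ?oppr_le0 ?invr_ge0 ?ltW.
  - rewrite le_eqVlt; apply/orP; left; rewrite eq_sym; apply/eqP; field.
    by rewrite (gt_eqF p1) pnatr_eq0 -lt0n p0.
  - by rewrite cubic_sum_eq0// sub0r mulNr mul1r.
have small : [|| p == 3, p == 7, p == 13 | p == 19]%N.
  by move: p p31 p_pr p3 {py p0 p1 l1 key}; do 31 case=> //.
case/or4P: small => /eqP pE.
- apply: (key (1 / 2) (- 1)); rewrite ?pE; try lra.
  have g := @cosq_geN1 R 3; rewrite /cubic_sum !big_ord_recl big_ord0 mul0r cosq0.
  set A := cosq 3 _; set B := cosq 3 _.
  have : -1 <= A := g _; have : -1 <= B := g _.
  by rewrite (_ : 3%:R - 1 = 2) ?ler_pdivlMr//; lra.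
- apply: (key (49 / 100) (- 95 / 100)); rewrite ?pE; try lra.
  by have := @cubic_sum7 R _ _ py pE; rewrite pE (_ : 7%:R - 1 = 6) //; ring.
(* The sharp case: the expression is a positive multiple of [x - c], so [c] has to be the smallest
   root of the cubic. *)
- have := @cubic_sum13_root R _ _ py pE; have := @cubic_sum13_root R 13%N 4 isT erefl.
  rewrite /= c13E pE lam13 L13E; set x := (_ - 1) / 3; set c := -2 * c13.
  move=> Pc Px; have c_le : c <= - 29 / 11 by rewrite /c; have := c13_ge; lra.
  suff xc : c <= x.
    have -> : (cubic_sum 13%N y - 1) / (13%:R - 1) = x / 4 by rewrite /x; field.
    have c0 : 0 < 2 + c13 by have := c13_ge; lra.
    have -> : c13 / (2 + c13) + (1 - c13 / (2 + c13)) * (x / 4) =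
        (x - c) / (2 * (2 + c13)) by rewrite /c; field; rewrite gt_eqF.
    by rewrite divr_ge0 ?subr_ge0// mulr_ge0// ltW.
  rewrite leNgt; apply/negP => xc.
  (* The difference of the cubic at its two roots [c] and [x], factored. The cofactor is positive
     because both roots lie below [- 29 / 11] or at it. *)
  have : (c - x) * (x ^+ 2 + x * c + c ^+ 2 + x + c - 4) = 0 by lra.
  apply/eqP; rewrite mulf_neq0// ?subr_eq0 ?(gt_eqF xc)// gt_eqF//.
  nra.
- apply: (key (17 / 50) (- 303 / 600)); rewrite ?pE; try lra.
  by have := @cubic_sum19 R _ _ py pE; rewrite pE (_ : 19%:R - 1 = 18) //; ring.
Qed.

Lemma lam3_ge : 1 / 2 <= lam 3%N.
Proof. by apply: lam_ge => //; lra. Qed.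

End exponent.

(** * Weights and witness functions *)

Section weights.
Context {R : realType}.
Implicit Types (m n p q i K : nat).

Lemma gcdn_coprimeM i m n : coprime m n ->
  gcdn i (m * n) = (gcdn i m * gcdn i n)%N.
Proof.
move=> co; apply/eqP; rewrite eqn_dvd; apply/andP; split.
  rewrite muln_gcdl dvdn_gcd; apply/andP; split.
    by rewrite dvdn_mulr ?dvdn_gcdl.
  by rewrite muln_gcdr dvdn_gcd dvdn_mull ?dvdn_gcdl//= dvdn_gcdr.
rewrite dvdn_gcd (dvdn_mul (dvdn_gcdr _ _) (dvdn_gcdr _ _)) andbT.
rewrite Gauss_dvd ?dvdn_gcdl//.
exact: coprime_dvdl (dvdn_gcdr _ _) (coprime_dvdr (dvdn_gcdr _ _) co).
Qed.

Lemma primesM_perm m n : (0 < m)%N -> (0 < n)%N -> coprime m n ->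
  perm_eq (primes (m * n)) (primes m ++ primes n).
Proof.
move=> m0 n0 co; apply: uniq_perm; first exact: primes_uniq.
  rewrite cat_uniq !primes_uniq andbT /= -coprime_has_primes//.
by move=> p; rewrite primesM// mem_cat.
Qed.

(** The probability that the random integer is a unit at every prime dividing [n]. *)
Definition kap n : R := \prod_(p <- primes n) (1 - lam p).

Lemma kapM m n : (0 < m)%N -> (0 < n)%N -> coprime m n ->
  kap (m * n) = kap m * kap n.
Proof. by move=> *; rewrite /kap (perm_big _ (primesM_perm _ _ _))// big_cat. Qed.

Lemma kap_pfactor p K : prime p -> kap (p ^ K.+1) = 1 - lam p.
Proof. by move=> p_pr; rewrite /kap primesX// primes_prime// big_seq1. Qed.

Lemma lam1 : lam 1 = 1 :> R. Proof. by rewrite /lam powR1. Qed.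

Lemma lamM m n : lam (m * n) = lam m * lam n :> R.
Proof. by rewrite /lam natrM powRM. Qed.

Lemma lam_ge0 n : 0 <= lam n :> R. Proof. exact: powR_ge0. Qed.

(* The mass of the residue class of [i] for the random profinite integer whose
   [p]-component is [p ^ v] times a Haar-distributed unit with probability
   [lam p ^ v * (1 - lam p)], independently for all [p]. *)
Definition weight q i : R :=
  let d := gcdn i q in lam d * kap (q %/ d) / (totient (q %/ d))%:R.

Lemma weight_mod q i : weight q (i %% q) = weight q i.
Proof. by rewrite /weight gcdn_modl. Qed.

Lemma weight_sub q i : (i <= q)%N -> weight q (q - i) = weight q i.
Proof.
move=> iq; rewrite /weight; suff -> : gcdn (q - i) q = gcdn i q by [].
by rewrite -{2}(subnK iq) gcdnDl -{2}(subnKC iq) gcdnDl gcdnC.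
Qed.

Lemma weight_ge0 q i : (0 < q)%N -> 0 <= weight q i.
Proof.
move=> q0; rewrite /weight divr_ge0 ?ler0n// mulr_ge0 ?lam_ge0// /kap.
rewrite big_seq; apply: prodr_ge0 => p; rewrite mem_primes => /and3P[p_pr _ _].
by rewrite subr_ge0 lam_le1// prime_gt0.
Qed.

Lemma weightM m n i : (0 < m)%N -> (0 < n)%N -> coprime m n ->
  weight (m * n) i = weight m i * weight n i.
Proof.
move=> m0 n0 co; rewrite /weight gcdn_coprimeM//.
set d := gcdn i m; set d' := gcdn i n.
have dm : (d %| m)%N by exact: dvdn_gcdr.
have dn : (d' %| n)%N by exact: dvdn_gcdr.
have d0 : (0 < d)%N by rewrite gcdn_gt0 m0 orbT.
have d'0 : (0 < d')%N by rewrite gcdn_gt0 n0 orbT.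
have -> : ((m * n) %/ (d * d') = (m %/ d) * (n %/ d'))%N.
  rewrite -{1}(divnK dm) -{1}(divnK dn) mulnACA mulnK//.
  by rewrite muln_gt0 d0.
have co' : coprime (m %/ d) (n %/ d').
  exact: coprime_dvdl (dvdn_div dm) (coprime_dvdr (dvdn_div dn) co).
rewrite lamM kapM ?divn_gt0 ?(dvdn_leq _ dm) ?(dvdn_leq _ dn)//.
by rewrite totient_coprime// natrM invfM; ring.
Qed.

Lemma weight1 i : weight 1 i = 1.
Proof. by rewrite /weight gcdn1 divn1 lam1 /kap big_nil !mul1r invr1. Qed.

Lemma weight_unit p K i : prime p -> ~~ (p %| i)%N ->
  weight (p ^ K.+1) i = (1 - lam p) / (totient (p ^ K.+1))%:R.
Proof.
move=> p_pr pi; rewrite /weight.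
have -> : gcdn i (p ^ K.+1) = 1%N.
  by apply/eqP; rewrite -/(coprime _ _) coprime_sym coprimeXl// prime_coprime.
by rewrite divn1 lam1 mul1r kap_pfactor.
Qed.

(** The valuation at [p] is geometric: given that [p] divides [N], the quotient [N / p] has the same
    [p]-component in law as [N]. *)
Lemma weight_pmul p K i : prime p ->
  weight (p ^ K.+1) (p * i) = lam p * weight (p ^ K) i.
Proof.
move=> p_pr; rewrite /weight expnS -muln_gcdr divnMl ?prime_gt0// lamM.
by rewrite -!mulrA.
Qed.

End weights.

(** * Sums over residues and the Chinese remainder theorem *)

Section periodic_sums.
Context {R : realType}.
Implicit Types (m n p q i K : nat) (F H : nat -> R).

Lemma sum_ord_mul m n F :
  \sum_(i < m * n) F i = \sum_(i < m) \sum_(t < n) F (i + m * t)%N.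
Proof.
rewrite -(big_mkord xpredT F) mulnC big_nat_mul exchange_big /= big_mkord.
apply: eq_bigr => t _; rewrite -{1}[(t * m)%N]add0n big_addn mulSn addnK big_mkord.
by apply: eq_bigr => i _; rewrite mulnC.
Qed.

Lemma sum_crt m n F H : (0 < m)%N -> (0 < n)%N -> coprime m n ->
  (forall i, F (i %% m)%N = F i) -> (forall i, H (i %% n)%N = H i) ->
  \sum_(i < m * n) F i * H i = (\sum_(i < m) F i) * (\sum_(i < n) H i).
Proof.
move=> m0 n0 co Fm Hn; rewrite big_distrlr pair_bigA /=.
pose h (k : 'I_(m * n)) : 'I_m * 'I_n :=
  (Ordinal (ltn_pmod k m0), Ordinal (ltn_pmod k n0)).
have h_inj : injective h.
  move=> k l [/eqP km /eqP kn]; apply/val_inj/eqP => /=.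
  rewrite -(modn_small (ltn_ord k)) -(modn_small (ltn_ord l)).
  by rewrite chinese_remainder// km kn.
have h_bij : bijective h.
  by apply: inj_card_bij => //; rewrite card_prod !card_ord.
rewrite (reindex h) /=; last by apply: onW_bij.
by apply: eq_bigr => k _; rewrite Fm Hn.
Qed.

Lemma sum_dvd p n F : (0 < p)%N ->
  \sum_(i < p * n | (p %| i)%N) F i = \sum_(j < n) F (p * j)%N.
Proof.
move=> p0; rewrite big_mkcond.
rewrite (sum_ord_mul p n (fun i => if (p %| i)%N then F i else 0)).
case: p p0 => // p _; rewrite (bigD1 ord0)//= [X in _ + X]big1 => [|i i0].
  by rewrite addr0; apply: eq_bigr => j _; rewrite add0n dvdn_mulr.
apply: big1 => j _; rewrite dvdn_addl ?dvdn_mulr// /dvdn modn_small//.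
by rewrite -(inj_eq val_inj) in i0; rewrite (negbTE i0).
Qed.

Lemma sum_odd_eq0 q F : F 0%N = 0 -> (forall i, (i <= q)%N -> F (q - i)%N = - F i) ->
  \sum_(i < q) F i = 0.
Proof.
move=> F0 odd; have Fq : F q = - F 0%N by rewrite -odd// subn0.
have E : F 0%N + \sum_(i < q) F i.+1 = \sum_(i < q) F i + F q.
  transitivity (\sum_(i < q.+1) F i); first by rewrite big_ord_recl.
  by rewrite big_ord_recr.
have : \sum_(i < q) F i = - \sum_(i < q) F i.+1.
  rewrite (reindex_inj rev_ord_inj) -sumrN; apply: eq_bigr => i _ /=.
  by rewrite -odd.
move: E; rewrite Fq F0; lra.
Qed.

End periodic_sums.

(** * The witness functions: multiplicativity, compatibility and recursion on prime powers *)

Section witness_functions.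
Context {R : realType}.
Implicit Types (m n p q i j K : nat) (y a b : int).
Local Notation weight := (@weight R).
Local Notation cosq := (@cosq R).
Local Notation sinq := (@sinq R).
Local Notation lam := (@lam R).

Definition witness q y : R := \sum_(i < q) weight q i * cosq q ((i ^ 3)%N%:Z * y).

Lemma eq_cube_mod q i j y : i = j %[mod q] ->
  ((i ^ 3)%N%:Z * y = (j ^ 3)%N%:Z * y %[mod q])%Z.
Proof.
by move=> ij; rewrite -modzMml modz_nat -modnXm ij modnXm -modz_nat modzMml.
Qed.

Lemma eq_witness q y z : (y = z %[mod q])%Z -> witness q y = witness q z.
Proof.
move=> yz; apply: eq_bigr => u _; congr (_ * _); apply: eq_cosq.
by rewrite -modzMmr yz modzMmr.
Qed.

(** The law of [N] is symmetric under [i -> q - i] and cubing is odd, so the expected exponential is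
    real. *)
Lemma sum_weight_sinq q y :
  \sum_(i < q) weight q i * sinq q ((i ^ 3)%N%:Z * y) = 0.
Proof.
apply: (sum_odd_eq0 (F := fun i => weight q i * sinq q ((i ^ 3)%N%:Z * y))).
  by rewrite mul0r /sinq mul0r mulr0 sin0 mulr0.
move=> i iq; rewrite weight_sub// -mulrN -sinqN; congr (_ * _).
apply: eq_sinq; have -> : ((q - i) ^ 3)%N%:Z * y =
    (q%:Z ^+ 2 - 3 * q%:Z * i%:Z + 3 * i%:Z ^+ 2) * y * q%:Z - (i ^ 3)%N%:Z * y.
  by rewrite !expnS !expn0 !PoszM -subzn//; ring.
by rewrite modzMDl.
Qed.

(** The fraction is [a / m + b / n], and the components of [N] modulo [m] and [n] are independent.
    The product of sines in the addition formula averages to 0. *)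
Lemma witnessM m n a b : (0 < m)%N -> (0 < n)%N -> coprime m n ->
  witness (m * n) (a * n%:Z + b * m%:Z) = witness m a * witness n b.
Proof.
move=> m0 n0 co; pose C q y i := weight q i * cosq q ((i ^ 3)%N%:Z * y).
pose S q y i := weight q i * sinq q ((i ^ 3)%N%:Z * y).
have Cmod q y i : C q y (i %% q)%N = C q y i.
  rewrite /C weight_mod; congr (_ * _); apply/eq_cosq/eq_cube_mod.
  by rewrite modn_mod.
have Smod q y i : S q y (i %% q)%N = S q y i.
  rewrite /S weight_mod; congr (_ * _); apply/eq_sinq/eq_cube_mod.
  by rewrite modn_mod.
transitivity (\sum_(i < m * n) (C m a i * C n b i - S m a i * S n b i)).
  apply: eq_bigr => -[i /= _] _; rewrite weightM//.
  rewrite [_ * (_ + _)]mulrDr cosqD [_ * (a * _)]mulrA [_ * (b * _)]mulrA.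
  rewrite cosq_scale// sinq_scale// [(m * n)%N]mulnC cosq_scale// sinq_scale//.
  by rewrite /C /S; ring.
rewrite big_split sumrN /= !sum_crt//.
by rewrite [\sum_(i < m) S m a i]sum_weight_sinq mul0r subr0.
Qed.

(** A residue class modulo [p ^ K] splits into [p] classes modulo [p ^ K.+1]. Masses of units split
    evenly; multiples of [p] reduce to a smaller [K]. *)
Lemma sum_weight_lift p K i : prime p -> (i < p ^ K)%N ->
  \sum_(t < p) weight (p ^ K.+1) (i + p ^ K * t) = weight (p ^ K) i.
Proof.
move=> p_pr; elim: K i => [|K IH] i iK.
  move: iK; rewrite expn0 ltnS leqn0 => /eqP ->; rewrite weight1.
  have p1 := prime_gt1 p_pr.
  rewrite -(big_mkord xpredT (fun t => weight (p ^ 1) (0 + 1 * t)%N)).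
  have w0 : weight (p ^ 1) (0 + 1 * 0) = lam p.
    by have := @weight_pmul R p 0 0 p_pr; rewrite muln0 weight1 mulr1.
  rewrite big_ltn ?prime_gt0// w0.
  rewrite (eq_big_nat _ _ (F2 := fun=> (1 - lam p) / (p.-1)%:R)) => [|t /andP[t0 tp]].
    rewrite sumr_const_nat subn1 -[_ *+ _]mulr_natr divfK; first by ring.
    by rewrite pnatr_eq0 -lt0n -ltnS prednK// prime_gt0.
  rewrite add0n mul1n weight_unit ?expn1 ?totient_prime//.
  by rewrite gtnNdvd.
have [/dvdnP[j iE]|pi] := boolP (p %| i)%N.
  move: iK; rewrite iE mulnC expnS ltn_pmul2l ?prime_gt0// => jK.
  rewrite -expnS weight_pmul// -IH// mulr_sumr; apply: eq_bigr => t _.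
  by rewrite -weight_pmul// mulnDr mulnA -expnS.
rewrite weight_unit// (eq_bigr (fun=> (1 - lam p) / (totient (p ^ K.+2))%:R)).
  rewrite sumr_const card_ord !totient_pfactor//= !natrM expnS natrM.
  have p0 : p%:R != 0 :> R by rewrite pnatr_eq0 -lt0n prime_gt0.
  have p1 : p.-1%:R != 0 :> R.
    by rewrite pnatr_eq0 -lt0n -ltnS prednK ?prime_gt1 ?prime_gt0.
  have pK : (p ^ K)%:R != 0 :> R by rewrite natrX expf_neq0.
  by rewrite -[_ *+ p]mulr_natr; field; rewrite p0 p1 pK.
by move=> t _; rewrite weight_unit// dvdn_addl// dvdn_mulr// expnS dvdn_mulr.
Qed.

Lemma witness_pfactor_lift p K y : prime p ->
  witness (p ^ K.+1) (y * p%:Z) = witness (p ^ K) y.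
Proof.
move=> p_pr; rewrite /witness expnSr.
rewrite (sum_ord_mul (p ^ K) p (fun i => weight (p ^ K * p) i *
  cosq (p ^ K * p) ((i ^ 3)%N%:Z * (y * p%:Z)))).
apply: eq_bigr => i _; rewrite -(@sum_weight_lift p K i)// mulr_suml.
apply: eq_bigr => t _; rewrite [_ * (y * _)]mulrA cosq_scale ?prime_gt0//.
congr (_ * _); first by rewrite expnSr.
by apply/eq_cosq/eq_cube_mod; rewrite addnC mulnC modnMDl.
Qed.

Lemma bezout_split m n y : coprime m n -> exists a b, y = a * n%:Z + b * m%:Z.
Proof.
move=> co; have [u [v uv]] := Bezoutz m n.
have {}uv : u * m%:Z + v * n%:Z = 1 by rewrite uv /gcdz /= (eqP co).
by exists (y * v), (y * u); rewrite -!mulrA -mulrDr addrC uv mulr1.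
Qed.

(** Only the [p]-part of the modulus changes: split [y / q] by Bezout as [a / m + b / p ^ K], lift
    the second factor and recombine. *)
Lemma witness_prime_lift p q y : prime p -> (0 < q)%N ->
  witness (q * p) (y * p%:Z) = witness q y.
Proof.
move=> p_pr q0; have [m pm qE] := pfactor_coprime p_pr q0.
move: (logn p q) qE => K qE.
have m0 : (0 < m)%N by move: q0; rewrite qE muln_gt0 => /andP[].
have pK L : (0 < p ^ L)%N by rewrite expn_gt0 prime_gt0.
have co L : coprime m (p ^ L) by rewrite coprimeXr// coprime_sym.
have [a [b yE]] := bezout_split y (co K).
rewrite qE {2}yE witnessM// -(witness_pfactor_lift _ _ p_pr) -witnessM//.
by rewrite -mulnA -expnSr yE expnSr PoszM; congr witness; ring.
Qed.

Lemma witness_lift q r y : (0 < q)%N -> (0 < r)%N ->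
  witness (q * r) (y * r%:Z) = witness q y.
Proof.
move=> q0; elim/ltn_ind: r => r IH r0.
have [r1|r1] := leqP r 1.
  have -> : r = 1%N by apply/eqP; rewrite eqn_leq r1.
  by rewrite muln1 mulr1.
have p_pr := pdiv_prime r1; have [k rE] := dvdnP (pdiv_dvd r).
have k0 : (0 < k)%N by move: r0; rewrite rE muln_gt0 => /andP[].
have kr : (k < r)%N by rewrite rE ltn_Pmulr// prime_gt1.
rewrite -(IH _ kr k0) rE mulnA PoszM mulrA witness_prime_lift ?muln_gt0 ?q0//.
Qed.

Lemma witness_compatible : self_compatible witness.
Proof.
move=> q1 q2 y1 y2 q10 q20 yq.
have E : y1 * q2%:Z = y2 * q1%:Z.
  apply/eqP; rewrite -(eqr_int rat) !intrM -eqr_div ?yq// pnatr_eq0 -lt0n//.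
by rewrite -(witness_lift y1 q10 q20) E mulnC witness_lift.
Qed.

Lemma witness1 y : witness 1 y = 1.
Proof.
rewrite /witness big_ord_recl big_ord0 addr0 weight1 mul1r /=.
by rewrite mul0r cosq0.
Qed.

Lemma witness0 q : (0 < q)%N -> witness q 0 = 1.
Proof.
by move=> q0; rewrite -(witness1 0) -(witness_lift 0 (ltn0Sn 0) q0) mul1n mul0r.
Qed.

Lemma sum_weight q : (0 < q)%N -> \sum_(i < q) weight q i = 1.
Proof.
move=> q0; rewrite -(witness0 q0); apply: eq_bigr => i _.
by rewrite mulr0 cosq0 mulr1.
Qed.

Definition unit_cubic_sum p K y : R :=
  \sum_(u < p ^ K | ~~ (p %| u)%N) cosq (p ^ K) ((u ^ 3)%N%:Z * y).

Lemma witness_pfactorS p K y : prime p -> witness (p ^ K.+1) y =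
  lam p * witness (p ^ K) (y * p%:Z ^+ 2) +
  (1 - lam p) * (unit_cubic_sum p K.+1 y / (totient (p ^ K.+1))%:R).
Proof.
move=> p_pr; rewrite /witness (bigID (fun i : 'I_ _ => p %| i)%N) /=.
congr (_ + _).
  have := sum_dvd (p ^ K) (fun i =>
    weight (p ^ K.+1) i * cosq (p ^ K.+1) ((i ^ 3)%N%:Z * y)) (prime_gt0 p_pr).
  rewrite -expnS => ->.
  rewrite mulr_sumr; apply: eq_bigr => j _; rewrite weight_pmul// -mulrA.
  congr (_ * (_ * _)); rewrite expnMn.
  have -> : (p ^ 3 * j ^ 3)%N%:Z * y = (j ^ 3)%N%:Z * (y * p%:Z ^+ 2) * p%:Z.
    by rewrite PoszM !expnS !expn0 !PoszM; ring.
  by rewrite expnSr cosq_scale// prime_gt0.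
rewrite /unit_cubic_sum mulr_suml mulr_sumr; apply: eq_bigr => i pi.
by rewrite weight_unit//; ring.
Qed.

(* Substituting [u + M * t] for [u] shifts the phase of [u ^ 3 * y] linearly in
   [t], so the sum over [t] vanishes. *)
Lemma unit_cubic_sum_eq0 p K M T y : prime p -> (p ^ K = M * T)%N ->
  (p %| M)%N -> (p ^ K %| 3 * M ^ 2)%N -> (p ^ K %| M ^ 3)%N ->
  (forall k : int, ~~ (p %| k)%Z -> ~~ (T %| 3 * k)%Z) ->
  ~~ (p %| y)%Z -> unit_cubic_sum p K y = 0.
Proof.
move=> p_pr pK pM dM2 dM3 T3 py; rewrite /unit_cubic_sum big_mkcond pK.
rewrite (sum_ord_mul M T (fun u => if ~~ (p %| u)%N
  then cosq (M * T) ((u ^ 3)%N%:Z * y) else 0)) big1// => u _.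
have [pu|pu] := boolP (p %| u)%N.
  by apply: big1 => t _; rewrite dvdn_addr// dvdn_mulr.
have pk : ~~ (p %| u%:Z ^+ 2 * y)%Z.
  move: py; rewrite !dvdzE abszM abszX Euclid_dvdM// Euclid_dvdX//= andbT.
  by rewrite negb_or pu.
have MT0 : (0 < M * T)%N by rewrite -pK expn_gt0 prime_gt0.
have [M0 T0] : (0 < M)%N /\ (0 < T)%N by apply/andP; rewrite -muln_gt0.
pose x : R := 2 * pi * (((u ^ 3)%N%:Z * y)%:~R / (M * T)%N%:R).
rewrite -[RHS](sum_cos_shift x (T3 _ pk)); apply: eq_bigr => t _.
rewrite dvdn_addl ?(dvdn_mulr _ pM)// pu.
(* The quadratic and cubic terms in [t] vanish modulo [p ^ K] by [dM2] and [dM3]; only the linear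
   one remains. *)
have -> : cosq (M * T) (((u + M * t) ^ 3)%N%:Z * y) =
    cosq (M * T) ((u ^ 3)%N%:Z * y + 3 * (u%:Z ^+ 2 * y) * t%:Z * M%:Z).
  apply: eq_cosq; apply/eqP; rewrite eqz_mod_dvd -pK.
  have -> : ((u + M * t) ^ 3)%N%:Z * y -
      ((u ^ 3)%N%:Z * y + 3 * (u%:Z ^+ 2 * y) * t%:Z * M%:Z) =
      u%:Z * t%:Z ^+ 2 * y * (3 * M ^ 2)%N%:Z + t%:Z ^+ 3 * y * (M ^ 3)%N%:Z.
    by rewrite PoszM !expnS !expn0 !PoszM PoszD !PoszM; ring.
  by rewrite rpredD// dvdz_mull.
rewrite /cosq intrD intrM natrM; congr cos.
rewrite /x natrM; field.
by rewrite !pnatr_eq0 -!lt0n M0 T0.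
Qed.

End witness_functions.

(** * Nonnegativity and the constant term *)

Lemma pfactor_ind (P : nat -> Prop) : P 1%N ->
  (forall p K m, prime p -> (0 < m)%N -> coprime m (p ^ K) -> P m ->
    P (m * p ^ K)%N) ->
  forall q, (0 < q)%N -> P q.
Proof.
move=> P1 PM; elim/ltn_ind => q IH q0.
have [q1|q1] := leqP q 1.
  by rewrite (_ : q = 1%N)//; apply/eqP; rewrite eqn_leq q1.
have p_pr := pdiv_prime q1; have [m pm qE] := pfactor_coprime p_pr q0.
have m0 : (0 < m)%N by move: q0; rewrite qE muln_gt0 => /andP[].
rewrite qE; apply: PM => //; first by rewrite coprimeXr// coprime_sym.
apply: IH => //; rewrite [X in (_ < X)%N]qE ltn_Pmulr// -[1%N](expn0 (pdiv q)).
by rewrite ltn_exp2l ?prime_gt1// logn_gt0 mem_primes p_pr q0 pdiv_dvd.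
Qed.

Section positivity.
Context {R : realType}.
Implicit Types (m n p q i j K E : nat) (y : int).
Local Notation weight := (@weight R).
Local Notation witness := (@witness R).
Local Notation lam := (@lam R).

Lemma unit_cubic_sum_neq3 p K y : prime p -> p != 3%N -> ~~ (p %| y)%Z ->
  unit_cubic_sum p K.+2 y = 0 :> R.
Proof.
move=> p_pr p3 py; apply: (@unit_cubic_sum_eq0 R p _ (p ^ K.+1) p) => //.
- by rewrite expnSr.
- by rewrite expnS dvdn_mulr.
- by rewrite dvdn_mull// -expnM dvdn_exp2l//; lia.
- by rewrite -expnM dvdn_exp2l//; lia.
- move=> k; rewrite !dvdzE abszM Euclid_dvdM// negb_or => ->.
  by rewrite andbT dvdn_prime2.
Qed.

(** The factor 3 in the linear term forces [T = 9], and [M] must still be a multiple of 3; hence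
    moduli from 27 on. *)
Lemma unit_cubic_sum_3 K y : ~~ (3%N %| y)%Z ->
  unit_cubic_sum 3 K.+3 y = 0 :> R.
Proof.
move=> py; apply: (@unit_cubic_sum_eq0 R 3 _ (3 ^ K.+1) 9) => //.
- by rewrite (_ : 9 = 3 ^ 2)%N// -expnD addn2.
- by rewrite expnS dvdn_mulr.
- by rewrite -expnM -expnS dvdn_exp2l//; lia.
- by rewrite -expnM dvdn_exp2l//; lia.
- move=> k; rewrite !dvdzE abszM; apply: contra.
  by rewrite (_ : `|9%N| = 3 * 3)%N// dvdn_pmul2l.
Qed.

Lemma witness_pfactor_ge0 p K y : prime p -> 0 <= witness (p ^ K) y.
Proof.
move=> p_pr; elim: K y => [|K IH] y; first by rewrite witness1.
have [/dvdzP[z ->]|py] := boolP (p %| y)%Z; first by rewrite witness_pfactor_lift.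
rewrite witness_pfactorS//.
have vanish : unit_cubic_sum p K.+1 y = 0 :> R ->
    0 <= lam p * witness (p ^ K) (y * p%:Z ^+ 2) +
      (1 - lam p) * (unit_cubic_sum p K.+1 y / (totient (p ^ K.+1))%:R).
  by move=> ->; rewrite mul0r mulr0 addr0 mulr_ge0 ?lam_ge0.
have [p3|p3] := eqVneq p 3%N; last first.
  case: K IH vanish => [_ _|K _ vanish]; last exact/vanish/unit_cubic_sum_neq3.
  rewrite witness1 mulr1 expn1 totient_prime// -subn1 natrB ?prime_gt0//.
  rewrite (_ : unit_cubic_sum p 1 y = cubic_sum p y - 1) ?local_positivity//.
  by rewrite cubic_sumN1// /unit_cubic_sum expn1.
rewrite p3 in py vanish IH *; case: K IH vanish => [_ _|[_ _|K _ vanish]].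
- rewrite witness1 mulr1 expn1 totient_prime// -subn1 natrB//.
  rewrite (_ : unit_cubic_sum 3 1 y = cubic_sum 3 y - 1) ?local_positivity//.
  by rewrite cubic_sumN1// /unit_cubic_sum expn1.
(* Modulo 9 the first term is [lam 3], since [9 y] vanishes modulo 3. The six unit terms are bounded
   trivially by -1, which [1 / 2 <= lam 3] compensates. *)
- rewrite (@eq_witness R _ _ 0) ?witness0 ?mulr1//; last first.
    by rewrite expn1 expr2 mulrA modzMl mod0z.
  have : - 6 <= unit_cubic_sum 3 2 y :> R.
    have -> : - 6 = \sum_(u < 3 ^ 2 | ~~ (3 %| u)%N) -1 :> R.
      by rewrite big_mkcond !big_ord_recl big_ord0 /=; ring.
    by apply: ler_sum => u _; exact: cosq_geN1.
  have := @lam3_ge R; have := @lam_le1 R 3 isT.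
  rewrite (_ : totient (3 ^ 2) = 6%N)//; move: (lam 3) (unit_cubic_sum 3 2 y).
  move=> l s l1 l2 s6; have : 0 <= (1 - l) * (s + 6) by rewrite mulr_ge0//; lra.
  lra.
- exact/vanish/unit_cubic_sum_3.
Qed.

Lemma witness_ge0 q y : (0 < q)%N -> 0 <= witness q y.
Proof.
move=> q0; elim/pfactor_ind: q0 y => [y|p K m p_pr m0 co IH y].
  by rewrite witness1.
have [a [b ->]] := bezout_split y co.
rewrite witnessM//; first by rewrite mulr_ge0// witness_pfactor_ge0.
by rewrite expn_gt0 prime_gt0.
Qed.

End positivity.

(** * The constant term and its bound *)

Section constant_term.
Context {R : realType}.
Implicit Types (m n p q i j K E : nat) (y : int).
Local Notation weight := (@weight R).
Local Notation lam := (@lam R).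

Let mu q : R := q%:R `^ (- epsilon13 R).

Let muX3 p : mu p ^+ 3 = lam p.
Proof.
rewrite -powR_mulrn ?powR_ge0// -powRrM /lam /sigma13; congr (_ `^ _); ring.
Qed.

Let mu_le1 p : (0 < p)%N -> mu p <= 1.
Proof.
move=> p0; rewrite -(powRr0 p%:R); apply: ler_powR; first by rewrite ler1n.
have := @sigma13_gt0 R; rewrite /sigma13; lra.
Qed.

(** Requiring [p] to divide [N] costs [lam p = mu p ^+ 3] and lowers [E] by 3, so induction on [K]
    needs [E] separate from [K]. *)
Lemma mass_pfactor p K E : prime p -> (E <= 3 * K)%N ->
  \sum_(i < p ^ K | (p ^ E %| i ^ 3)%N) weight (p ^ K) i <= mu p ^+ E.
Proof.
move=> p_pr; have p0 := prime_gt0 p_pr.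
have mass0 L : \sum_(i < p ^ L | (p ^ 0 %| i ^ 3)%N) weight (p ^ L) i <= mu p ^+ 0.
  rewrite expr0 -(@sum_weight R (p ^ L)) ?expn_gt0 ?p0//.
  by under eq_bigl do rewrite expn0 dvd1n.
elim: K E => [|K IH] [|E] EK //.
pose F i := if (p ^ E.+1 %| i ^ 3)%N then weight (p ^ K.+1) i else 0.
have -> : \sum_(i < p ^ K.+1 | (p ^ E.+1 %| i ^ 3)%N) weight (p ^ K.+1) i =
    \sum_(i < p ^ K.+1 | (p %| i)%N) F i.
  rewrite big_mkcond [RHS]big_mkcond; apply: eq_bigr => i _; rewrite /F.
  case: ifP => [pi|_]; last by rewrite if_same.
  suff -> : (p %| i)%N by [].
  have : (p %| i ^ 3)%N by apply: dvdn_trans pi; rewrite expnS dvdn_mulr.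
  by rewrite Euclid_dvdX// andbT.
have -> : \sum_(i < p ^ K.+1 | (p %| i)%N) F i = \sum_(j < p ^ K) F (p * j)%N.
  by rewrite expnS; exact: sum_dvd.
have -> : \sum_(j < p ^ K) F (p * j)%N =
    lam p * \sum_(j < p ^ K | (p ^ (E.+1 - 3) %| j ^ 3)%N) weight (p ^ K) j.
  rewrite mulr_sumr [RHS]big_mkcond; apply: eq_bigr => j _.
  rewrite /F weight_pmul// expnMn.
  have [E3|E3] := leqP 3 E.+1.
    by rewrite -{1}(subnKC E3) expnD dvdn_pmul2l// expn_gt0 p0.
  rewrite (_ : E.+1 - 3 = 0)%N ?expn0 ?dvd1n; last by lia.
  by rewrite dvdn_mulr// dvdn_exp2l// ltnW.
(* With truncated subtraction the exponent is the maximum of 3 and [E.+1], and [mu p <= 1]. *)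
apply: (@le_trans _ _ (mu p ^+ (3 + (E.+1 - 3)))); last first.
  by rewrite ler_wiXn2l ?powR_ge0 ?mu_le1//; lia.
by rewrite exprD muX3 ler_wpM2l ?lam_ge0// IH//; lia.
Qed.

Definition mass q : R := \sum_(i < q | (q %| i ^ 3)%N) weight q i.

Lemma massM m n : (0 < m)%N -> (0 < n)%N -> coprime m n ->
  mass (m * n) = mass m * mass n.
Proof.
move=> m0 n0 co; pose F q i : R := if (q %| i ^ 3)%N then weight q i else 0.
have Fmod q i : F q (i %% q)%N = F q i.
  by rewrite /F weight_mod /dvdn modnXm.
have massE q : mass q = \sum_(i < q) F q i by rewrite /mass big_mkcond.
rewrite !massE -sum_crt//; apply: eq_bigr => i _.
rewrite /F Gauss_dvd//; case: (m %| _)%N; last by rewrite mul0r.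
by case: (n %| _)%N; rewrite /= ?weightM ?mulr0.
Qed.

Lemma mass_le q : (0 < q)%N -> mass q <= q%:R `^ (- epsilon13 R).
Proof.
move=> q0; elim/pfactor_ind: q0 => [|p K m p_pr m0 co IH].
  rewrite powR1 /mass; under eq_bigl do rewrite dvd1n.
  by rewrite (@sum_weight R 1).
have pK0 : (0 < p ^ K)%N by rewrite expn_gt0 prime_gt0.
have mass_ge0 n : (0 < n)%N -> 0 <= mass n.
  by move=> n0; apply: sumr_ge0 => i _; exact: weight_ge0.
rewrite massM// natrM powRM//; apply: ler_pM; rewrite ?mass_ge0//.
rewrite natrX -powR_mulrn// powRAC powR_mulrn ?powR_ge0//.
by apply: mass_pfactor => //; lia.
Qed.

(** The weight is halved since [e(x) + e(-x)] is twice a cosine. Residues whose cube vanishes modulo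
    [q] contribute constants, which are gathered in the coefficient at 0. *)
Definition witness_coef q j : R :=
  if j == 0%N then mass q else weight q j / 2.

Lemma witnessE q y : (0 < q)%N -> witness q y = witness_coef q 0 +
  \sum_(1 <= j < q | ~~ (q %| j ^ 3)%N)
    witness_coef q j * (2 * cosq q ((j ^ 3)%N%:Z * y)).
Proof.
move=> q0; rewrite /witness (bigID (fun i : 'I_q => q %| i ^ 3)%N) /=.
congr (_ + _).
  rewrite /witness_coef eqxx /mass; apply: eq_bigr => i /dvdnP[k kE].
  rewrite (@eq_cosq R q _ 0) ?cosq0 ?mulr1// kE.
  by rewrite PoszM mulrAC modzMl mod0z.
rewrite -(big_mkord (fun i => ~~ (q %| i ^ 3)%N)
  (fun i => weight q i * cosq q ((i ^ 3)%N%:Z * y))).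
rewrite big_ltn_cond// dvdn0 /= big_nat_cond [RHS]big_nat_cond.
apply: eq_bigr => j /andP[/andP[j0 _] _].
by rewrite /witness_coef gtn_eqF//; field.
Qed.

Lemma witness_cubic q : (0 < q)%N ->
  cubic_modular_witness q (witness_coef q) (witness q).
Proof.
move=> q0; split => [y|y _|]; [|exact: witness_ge0|exact: witness0].
rewrite witnessE// rmorphD; congr (_ + _).
rewrite rmorph_sum; apply: eq_bigr => j _ /=.
rewrite rmorphM /=; congr (_ * _); rewrite /e_unit /cosq intrM mulrN cosN sinN.
by apply/eqP; rewrite eq_complex /= subrr eqxx andbT; apply/eqP; ring.
Qed.

End constant_term.

Theorem theorem2p5 (R : realType) :
  (exists (b : nat -> nat -> R) (g : nat -> int -> R),
     [/\ forall q : nat, (0 < q)%N -> cubic_modular_witness q (b q) (g q),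
         self_compatible g
       & forall q : nat, (0 < q)%N -> b q 0%N <= q%:R `^ (- epsilon13 R)]) /\
  (forall q : nat, (0 < q)%N -> lambda_C0 R q <= q%:R `^ (- epsilon13 R)).
Proof.
split.
  exists witness_coef, witness; split; first exact: witness_cubic.
    exact: witness_compatible.
  exact: mass_le.
move=> q q0; apply: le_trans (mass_le q0); apply: (lambda_C0_min R q0).2.
by exists (witness_coef q), (witness q); split; first exact: witness_cubic.
Qed.
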